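(* Let $X$ and $Y$ be simply connected CW complexes with $\dim H^*(X;\mathbb{Q})<\infty$ and $\dim H^*(Y;\mathbb{Q})<\infty$. Then $\mathcal{H}(X)=\mathcal{H}(Y)$ if and only if the graphs $G\mathcal{H}(X)$ and $G\mathcal{H}(Y)$ are isomorphic as based graphs (i.e. there is a graph isomorphism carrying base point to base point).
   Context: All spaces are simply connected CW complexes (of finite type) with finite-dimensional rational cohomology; $X_{\mathbb{Q}}$ denotes rationalization and $M(X)=(\Lambda V,d)$ the Sullivan minimal model. Rational toral rank. $r_0(X)$ is the largest integer $r$ such that the torus $T^r=S^1\times\cdots\times S^1$ acts continuously on some CW complex in the rational homotopy type of $X$ with all isotropy groups finite (an almost free action). Equivalently (Halperin), $r_0(X)\ge r$ iff there is a Koszul–Sullivan (KS) extension $(\mathbb{Q}[t_1,\dots,t_r],0)\to(\mathbb{Q}[t_1,\dots,t_r]\otimes\Lambda V,D)\to(\Lambda V,d)$ with $|t_i|=2$, $Dt_i=0$, $Dv\equiv dv$ modulo $(t_1,\dots,t_r)$ for $v\in V$, and $\dim H^*(\mathbb{Q}[t_1,\dots,t_r]\otimes\Lambda V,D)<\infty$. The set $\mathcal{X}$. $\mathcal{X}_0=\{X_{\mathbb{Q}}\}$, and for $n>0$, $\mathcal{X}_n$ is the set of rational homotopy types of Borel spaces $(ET^n\times_{T^n}X_\mu)_{\mathbb{Q}}$ of almost free $T^n$-actions $\mu$ on complexes $X_\mu$ in the rational homotopy type of $X$; equivalently, the set of isomorphism classes of models $(\mathbb{Q}[t_1,\dots,t_n]\otimes\Lambda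 V,D)$ as in the previous paragraph (with $r=n$) having finite-dimensional cohomology. Put $\mathcal{X}=\coprod_{n=0}^{r_0(X)}\mathcal{X}_n$. For $Y_1\in\mathcal{X}_m$, $Y_2\in\mathcal{X}_n$ with $m<n$, write $Y_1<Y_2$ if there is a rationalized Borel fibration $Y_1\to Y_2\to BT^{n-m}_{\mathbb{Q}}$ compatible up to homotopy with the Borel fibrations $X_{\mathbb{Q}}\to Y_1\to BT^m_{\mathbb{Q}}$ and $X_{\mathbb{Q}}\to Y_2\to BT^n_{\mathbb{Q}}$, the identity of $X_{\mathbb{Q}}$, and the fibration $BT^m_{\mathbb{Q}}\to BT^n_{\mathbb{Q}}\to BT^{n-m}_{\mathbb{Q}}$ induced by the inclusion of the first $m$ factors. In models: there are models $(\mathbb{Q}[t_1,\dots,t_m]\otimes\Lambda V,D_1)$ of $Y_1$ and $(\mathbb{Q}[t_1,\dots,t_n]\otimes\Lambda V,D_2)$ of $Y_2$ and a KS extension $(\mathbb{Q}[t_{m+1},\dots,t_n],0)\to(\mathbb{Q}[t_1,\dots,t_n]\otimes\Lambda V,D_2)\to(\mathbb{Q}[t_1,\dots,t_m]\otimes\Lambda V,D_1)$ that is compatible up to homotopy with the projections to $(\Lambda V,d)$ and with the inclusions of $\mathbb{Q}[t_1,\dots,t_n]$, $\mathbb{Q}[t_1,\dots,t_m]$. The poset $\mathcal{T}_0(X)$. For $Y_1,Y_2\in\mathcal{X}$ put $Y_1\sim Y_2$ if $Y_1,Y_2\in\mathcal{X}_n$ for the same $n$ and $r_0(Y_1)=r_0(Y_2)$.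 Let $\mathcal{T}_0(X)=\mathcal{X}/\!\sim$, with the order $<$ that is the transitive closure of: $P<P'$ if there are $Y,Y'\in\mathcal{X}$ with $[Y]=P$, $[Y']=P'$, $Y<Y'$. Its minimal element is $P_0=[X_{\mathbb{Q}}]$. Hasse diagram and graph. $\mathcal{H}(X)$ is the Hasse diagram of $\mathcal{T}_0(X)$. $G\mathcal{H}(X)$ is the underlying finite, simple, undirected graph, with vertex set $\mathcal{T}_0(X)$, an edge $PP'$ whenever $P<P'$ and no $P''$ satisfies $P<P''<P'$, and base point $P_0$. Every $P=[Y]\in\mathcal{T}_0(X)$ has a double index $d.i.(P)=(s,t)\in\mathbb{Z}_{\ge0}\times\mathbb{Z}_{\ge0}$ defined by $Y\in\mathcal{X}_t$ and $r_0(Y)=r_0(X)-s-t$; distinct points have distinct double indices. $\mathcal{H}(X)$ is realized in $\mathbb{R}_{\ge0}\times\mathbb{R}_{\ge0}$ by placing $P$ at $d.i.(P)$ and drawing each edge $PP'$ as the line segment from $d.i.(P)$ to $d.i.(P')$. The equality $\mathcal{H}(X)=\mathcal{H}(Y)$ means that these realizations coincide: the same set of lattice points occurs as vertices, and the same pairs of lattice points are joined by edges. *)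

(* Defs.v *)
From HB Require Import structures.
From mathcomp Require Import all_boot all_order all_algebra.
From mathcomp Require Import mpoly.
From Stdlib Require Import Relation_Operators ClassicalEpsilon.

Set Implicit Arguments.
Unset Strict Implicit.
Unset Printing Implicit Defensive.

Import GRing.Theory.
Local Open Scope ring_scope.

(* The rational homotopy type of a simply connected CW complex of finite type
   is represented by its Sullivan minimal model, a commutative differential
   graded algebra over rat satisfying [minimal_sullivan] below; almost free
   torus actions and their Borel spaces are represented by KS extensions of
   this model, which is Halperin's criterion. *)

(* hom n a means that a is homogeneous of degree n; hom_span and hom_indep say
   that the algebra is the direct sum of its homogeneous parts.  In
   characteristic 0 the rule gcomm forces a * a = 0 for a of odd degree. *)
Record cga := Cga {
  cga_alg :> algType rat;
  hom : nat -> cga_alg -> Prop;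
  hom0 : forall n, hom n 0;
  hom_lin : forall n (c : rat) a b, hom n a -> hom n b -> hom n (c *: a + b);
  hom1 : hom 0 1;
  homM : forall m n a b, hom m a -> hom n b -> hom (m + n) (a * b);
  hom_span : forall a, exists (N : nat) (f : nat -> cga_alg),
    (forall i, hom i (f i)) /\ a = \sum_(i < N) f i;
  hom_indep : forall (N : nat) (f : nat -> cga_alg),
    (forall i, hom i (f i)) -> \sum_(i < N) f i = 0 ->
    forall i, (i < N)%N -> f i = 0;
  gcomm : forall m n a b, hom m a -> hom n b ->
    b * a = (-1) ^+ (m * n) * (a * b)
}.
Arguments hom {_} n a.

Record is_differential (A : cga) (d : A -> A) : Prop := IsDifferential {
  diff_lin : forall (c : rat) a b, d (c *: a + b) = c *: d a + d b;
  diff_deg : forall n a, hom n a -> hom n.+1 (d a);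
  diff_leibniz : forall n a b, hom n a ->
    d (a * b) = d a * b + (-1) ^+ n * (a * d b);
  diff_sq : forall a, d (d a) = 0
}.

Record cdga := Cdga {
  cdga_cga :> cga;
  diff : cdga_cga -> cdga_cga;
  diffP : is_differential diff
}.
Arguments diff {_} a.

Definition graded (A B : cga) (f : A -> B) : Prop :=
  forall n a, hom n a -> hom n (f a).

Definition cdga_morph (A B : cdga) (f : {lrmorphism A -> B}) : Prop :=
  graded f /\ forall a, f (diff a) = diff (f a).

Definition cdga_iso (A B : cdga) : Prop :=
  exists f : {lrmorphism A -> B}, bijective f /\ cdga_morph f.

Definition fin_coh (A : cdga) : Prop :=
  exists (N : nat) (z : 'I_N -> A), (forall i, diff (z i) = 0) /\
    forall a, diff a = 0 ->
      exists (c : 'I_N -> rat) (b : A), a = \sum_i c i *: z i + diff b.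

(* H : A -> B (x) Lambda(u, du), |u| = 0, with H a = F a + (G a) du, where F a
   and G a are polynomials in u with coefficients in B; H is spelled out to be
   a morphism of differential graded algebras with value f at u = 0 and g at
   u = 1. *)
Definition homotopic (A B : cdga) (f g : A -> B) : Prop :=
  exists F G : A -> {poly B},
    [/\ forall (c : rat) a b, F (c *: a + b) = c%:A *: F a + F b,
        forall (c : rat) a b, G (c *: a + b) = c%:A *: G a + G b,
        F 1 = 1 /\ G 1 = 0
      & forall a b, F (a * b) = F a * F b] /\
    [/\ forall n a b, hom n b ->
          G (a * b) = F a * G b + (-1) ^+ n * (G a * F b),
        forall n a, hom n a -> forall k, hom n (F a)`_k,
        forall a, hom 0 a -> G a = 0
      & forall n a, hom n.+1 a -> forall k, hom n (G a)`_k] /\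
    [/\ forall a k, (F (diff a))`_k = diff (F a)`_k,
        forall n a, hom n a -> forall k,
          (G (diff a))`_k = diff (G a)`_k + (-1) ^+ n * ((F a)^`())`_k,
        forall a, (F a).[0] = f a
      & forall a, (F a).[1] = g a].

(* Linear span of the words of length at least k in the generators x i, that
   is Lambda^{>= k} V when x is a basis of V. *)
Definition words (A : cga) (I : Type) (x : I -> A) (k : nat) (a : A) : Prop :=
  exists s : seq (rat * seq I), all (fun cw => k <= size cw.2)%N s /\
    a = \sum_(cw <- s) cw.1 *: \prod_(i <- cw.2) x i.

(* A = Lambda V, where V has the homogeneous basis x with |x i| = deg i. *)
Definition free_cga (A : cga) (I : Type) (deg : I -> nat) (x : I -> A) : Prop :=
  [/\ forall i, hom (deg i) (x i),
      forall a, words x 0 a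
    & forall (B : cga) (y : I -> B), (forall i, hom (deg i) (y i)) ->
        exists f : {lrmorphism A -> B}, graded f /\ forall i, f (x i) = y i].

(* (Lambda V, d) with V = V^{>= 2} of finite type and d V in Lambda^{>= 2} V.
   Since V = V^{>= 2}, the nilpotence condition on d is automatic: d v only
   involves generators of degree less than |v|. *)
Definition minimal_sullivan (A : cdga) : Prop :=
  exists (I : choiceType) (deg : I -> nat) (x : I -> A),
    [/\ free_cga deg x,
        forall i, (2 <= deg i)%N,
        forall n, exists s : seq I, forall i, deg i = n -> i \in s
      & forall i, words x 2 (diff (x i))].

(* Q[t_1,...,t_n] (x) A with |t_i| = 2, as a rat-algebra. *)
Definition mpext (A : algType rat) (n : nat) := {mpoly A[n]}.

Section MpextAlg.
Variables (A : algType rat) (n : nat).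

HB.instance Definition _ := GRing.NzRing.copy (mpext A n) {mpoly A[n]}.

Definition mpext_scale (c : rat) (p : mpext A n) : mpext A n :=
  (c%:A : A) *: (p : {mpoly A[n]}).

Fact mpext_scaleA c1 c2 p :
  mpext_scale c1 (mpext_scale c2 p) = mpext_scale (c1 * c2) p.
Proof. by rewrite /mpext_scale scalerA -scalerAl mul1r scalerA. Qed.

Fact mpext_scale1 : left_id 1 mpext_scale.
Proof. by move=> p; rewrite /mpext_scale !scale1r. Qed.

Fact mpext_scaleDr : right_distributive mpext_scale +%R.
Proof. by move=> c p q; rewrite /mpext_scale scalerDr. Qed.

Fact mpext_scaleDl p : {morph mpext_scale^~ p : a b / a + b}.
Proof. by move=> c1 c2; rewrite /mpext_scale !scalerDl. Qed.

HB.instance Definition _ := GRing.Zmodule_isLmodule.Build rat (mpext A n)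
  mpext_scaleA mpext_scale1 mpext_scaleDr mpext_scaleDl.

Fact mpext_scaleE (c : rat) (p : mpext A n) m : (c *: p)@_m = c *: p@_m.
Proof. by rewrite [LHS]mcoeffZ mulr_algl. Qed.

Fact mpext_scaleAl (c : rat) (p q : mpext A n) : c *: (p * q) = c *: p * q.
Proof. exact: scalerAl. Qed.

HB.instance Definition _ :=
  GRing.Lmodule_isLalgebra.Build rat (mpext A n) mpext_scaleAl.

Fact mpext_scaleAr (c : rat) (p q : mpext A n) : c *: (p * q) = p * (c *: q).
Proof.
apply/mpolyP => m; rewrite mpext_scaleE !mcoeffM scaler_sumr.
by apply: eq_bigr => k _; rewrite mpext_scaleE scalerAr.
Qed.

HB.instance Definition _ :=
  GRing.Lalgebra_isAlgebra.Build rat (mpext A n) mpext_scaleAr.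
End MpextAlg.

Section PolyExt.
Variables (A : cga) (r : nat).

(* a *: 'X_[m] has degree n, where |t_i| = 2. *)
Definition coef_hom (n : nat) (m : 'X_{1..r}) (a : A) : Prop :=
  a = 0 \/ exists2 k : nat, (k + (mdeg m).*2)%N = n & hom k a.

Definition polyext_hom (n : nat) (p : mpext A r) : Prop :=
  forall m : 'X_{1..r}, coef_hom n m p@_m.

Fact coef_hom_lin n m (c : rat) a b :
  coef_hom n m a -> coef_hom n m b -> coef_hom n m (c *: a + b).
Proof.
move=> [->|[k kn ha]] [->|[l ln hb]].
- by left; rewrite scaler0 addr0.
- by right; exists l => //; rewrite scaler0 add0r.
- by right; exists k => //; apply: hom_lin => //; apply: hom0.
- right; exists k => //; apply: hom_lin => //.
  by move: ln; rewrite -kn => /addIn <-.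
Qed.

Fact coef_homD n m a b :
  coef_hom n m a -> coef_hom n m b -> coef_hom n m (a + b).
Proof. by move=> ha hb; rewrite -[a]scale1r; apply: coef_hom_lin. Qed.

Fact polyext_hom0 n : polyext_hom n 0.
Proof. by move=> m; left; rewrite mcoeff0. Qed.

Fact polyext_hom_lin n (c : rat) p q :
  polyext_hom n p -> polyext_hom n q -> polyext_hom n (c *: p + q).
Proof.
by move=> hp hq m; rewrite mcoeffD mpext_scaleE; apply: coef_hom_lin;
  [apply: hp|apply: hq].
Qed.

Fact polyext_hom1 : polyext_hom 0 1.
Proof.
move=> m; rewrite mcoeff1; case: eqP => [->|_]; last by left.
by right; exists 0%N; [rewrite mdeg0 | apply: hom1].
Qed.

Fact polyext_homM m n p q :
  polyext_hom m p -> polyext_hom n q -> polyext_hom (m + n) (p * q).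
Proof.
move=> hp hq k; rewrite mcoeffM.
apply: (big_ind (coef_hom (m + n) k)) => [|a b|]; [by left | exact: coef_homD |].
case=> k1 k2 /= /eqP ek.
have dk : mdeg k = (mdeg k1 + mdeg k2)%N by rewrite [in LHS]ek mdegD.
case: (hp k1) => [->|[a ea ha]]; first by left; rewrite mul0r.
case: (hq k2) => [->|[b eb hb]]; first by left; rewrite mulr0.
right; exists (a + b)%N; last exact: homM.
by rewrite dk doubleD -ea -eb addnACA.
Qed.

Fact polyext_hom_span p : exists (N : nat) (f : nat -> mpext A r),
  (forall i, polyext_hom i (f i)) /\ p = \sum_(i < N) f i.
Proof.
rewrite [p]mpolyE; elim/big_ind: _.
- by exists 0%N, (fun=> 0); split=> [i|]; [exact: polyext_hom0 | rewrite big_ord0].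
- move=> q q' [N [f [hf ->]]] [N' [f' [hf' ->]]].
  exists (N + N')%N, (fun i => (if (i < N)%N then f i else 0)
                             + (if (i < N')%N then f' i else 0)).
  split=> [i|].
    rewrite -[X in X + _]scale1r; apply: polyext_hom_lin;
      by case: ifP => _; [exact: hf || exact: hf' | exact: polyext_hom0].
  rewrite big_split /=; congr (_ + _); rewrite -big_mkcond /=.
    by rewrite (big_ord_widen_cond (N + N') xpredT f) ?leq_addr.
  by rewrite (big_ord_widen_cond (N + N') xpredT f') ?leq_addl.
move=> m _; have [N [f [hf ->]]] := hom_span p@_m.
exists ((mdeg m).*2 + N)%N, (fun i => if (i < (mdeg m).*2)%N then 0 else
   (f (i - (mdeg m).*2)%N) *: ('X_[m] : {mpoly A[r]})).
split=> [i k|].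
  case: ltnP => [_|lei]; first by left; rewrite mcoeff0.
  rewrite mcoeffZ mcoeffX; case: eqP => [<-|_]; last by left; rewrite mulr0.
  by right; exists (i - (mdeg m).*2)%N; rewrite ?subnK // mulr1.
rewrite scaler_suml big_split_ord /= [X in _ = X + _]big1 ?add0r => [|i _];
  last by rewrite ltn_ord.
by apply: eq_bigr => i _; rewrite ltnNge leq_addr /= addKn.
Qed.

Fact polyext_hom_indep (N : nat) (f : nat -> mpext A r) :
  (forall i, polyext_hom i (f i)) -> \sum_(i < N) f i = 0 ->
  forall i, (i < N)%N -> f i = 0.
Proof.
move=> hf sf0 i ltiN; apply/mpolyP=> m; rewrite mcoeff0.
have [//|[k ki _]] := hf i m.
pose s := (mdeg m).*2.
have hg j : hom j (f (j + s)%N)@_m.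
  by have [->|[l /addIn -> //]] := hf (j + s)%N m; apply: hom0.
have leN : (s <= N)%N by rewrite (leq_trans _ (ltnW ltiN)) // -ki leq_addl.
rewrite -ki; apply: (@hom_indep A (N - s) (fun j => (f (j + s)%N)@_m)) => //.
  have := congr1 (mcoeff m) sf0; rewrite raddf_sum mcoeff0 /=.
  rewrite -(big_mkord xpredT (fun i => (f i)@_m)) (big_cat_nat (n := s)) //=.
  rewrite big_nat big1 ?add0r => [|j /andP[_ ltjs]].
    by rewrite -{1}[s]add0n big_addn big_mkord.
  have [//|[l lj]] := hf j m.
  by move: ltjs; rewrite -lj ltnNge leq_addl.
by rewrite ltn_subRL addnC ki.
Qed.

Fact polyext_gcomm m n p q : polyext_hom m p -> polyext_hom n q ->
  q * p = (-1) ^+ (m * n) * (p * q).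
Proof.
move=> hp hq; rewrite -signr_odd mulr_sign.
suff e k : (q * p)@_k = (-1) ^+ odd (m * n) * (p * q)@_k.
  by apply/mpolyP=> k; rewrite e mulr_sign; case: ifP => // _; rewrite mcoeffN.
rewrite mcoeffM mcoeffMr mulr_sumr; apply: eq_bigr => -[k1 k2] _ /=.
case: (hp k2) => [->|[a ea ha]]; first by rewrite mulr0 mul0r mulr0.
case: (hq k1) => [->|[b eb hb]]; first by rewrite mul0r !mulr0.
rewrite (gcomm ha hb) -signr_odd !oddM -ea -eb !oddD !odd_double !addbF.
by [].
Qed.

Definition polyext : cga :=
  Cga polyext_hom0 polyext_hom_lin polyext_hom1 polyext_homM
      polyext_hom_span polyext_hom_indep polyext_gcomm.

Definition tvar (i : 'I_r) : polyext := ('X_i : {mpoly A[r]}).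

Definition scal (a : A) : polyext := (a%:MP : {mpoly A[r]}).

(* The augmentation t_1, ..., t_r |-> 0; its kernel is the ideal (t_1,...,t_r). *)
Definition aug (p : polyext) : A := (p : {mpoly A[r]})@_0%MM.
End PolyExt.

Section KSExtensions.
Variables (A : cdga) (r : nat).

(* A KS extension (Q[t_1..t_r], 0) -> (Q[t_1..t_r] (x) A, D) -> (A, d); for
   A = Lambda V the last field is D v = d v mod (t_1,...,t_r), extended from the
   generators v to all of A by multiplicativity.  No nilpotence condition is
   needed on D, for the reason given at [minimal_sullivan]. *)
Record ks_ext := KsExt {
  ks_diff : polyext A r -> polyext A r;
  ks_diffP : is_differential ks_diff;
  ks_tvar : forall i, ks_diff (tvar A i) = 0;
  ks_mod : forall a : A, aug (ks_diff (scal r a)) = diff a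
}.

Definition ks_cdga (E : ks_ext) : cdga := Cdga (ks_diffP E).
End KSExtensions.
Coercion ks_cdga : ks_ext >-> cdga.

Definition toral_rank_ge (A : cdga) (r : nat) : Prop :=
  exists E : ks_ext A r, fin_coh E.

(* The rational toral rank, i.e. the largest r with [toral_rank_ge A r]. *)
Definition r0 (A : cdga) : nat := epsilon (inhabits 0%N) (fun r =>
  toral_rank_ge A r /\ forall r', toral_rank_ge A r' -> (r' <= r)%N).

(* Classes of an equivalence relation R on T, as predicates on T. *)
Definition quotient (T : Type) (R : T -> T -> Prop) : Type :=
  {P : T -> Prop | exists x, P = R x}.

Definition in_class (T : Type) (R : T -> T -> Prop) (x : T) (P : quotient R) :=
  proj1_sig P x.

Definition class (T : Type) (R : T -> T -> Prop) (x : T) : quotient R :=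
  exist _ (R x) (ex_intro _ x erefl).

(* Models (Q[t_1..t_n] (x) Lambda V, D) of the Borel spaces of almost free
   T^n-actions, for all n at once. *)
Record borel (A : cdga) := Borel {
  rk : nat;
  borel_ext : ks_ext A rk;
  borel_fin : fin_coh borel_ext
}.

Definition borel_cdga (A : cdga) (E : borel A) : cdga := ks_cdga (borel_ext E).
Coercion borel_cdga : borel >-> cdga.

Definition borel_iso (A : cdga) (E1 E2 : borel A) : Prop :=
  rk E1 = rk E2 /\ cdga_iso E1 E2.

(* The disjoint union of the sets X_n of rational homotopy types.  There is no
   need to impose n <= r_0(X), since X_n is empty for n > r_0(X). *)
Definition calX (A : cdga) : Type := quotient (@borel_iso A).

Definition rat_hom (n : nat) (c : rat^o) : Prop := n = 0%N \/ c = 0.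

Fact rat_hom0 n : rat_hom n 0.
Proof. by right. Qed.

Fact rat_hom_lin n (c : rat) a b :
  rat_hom n a -> rat_hom n b -> rat_hom n (c *: a + b).
Proof.
case=> [->|->]; first by left.
by case=> [->|->]; [left | right; rewrite scaler0 addr0].
Qed.

Fact rat_hom1 : rat_hom 0 1.
Proof. by left. Qed.

Fact rat_homM m n a b : rat_hom m a -> rat_hom n b -> rat_hom (m + n) (a * b).
Proof.
case=> [->|->]; last by right; rewrite mul0r.
by case=> [->|->]; [left | right; rewrite mulr0].
Qed.

Fact rat_hom_span (a : rat^o) : exists (N : nat) (f : nat -> rat^o),
  (forall i, rat_hom i (f i)) /\ a = \sum_(i < N) f i.
Proof.
exists 1%N, (fun i => if i == 0%N then a else 0); rewrite big_ord1; split=> // i.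
by case: eqP => [->|_]; [left | right].
Qed.

Fact rat_hom_indep (N : nat) (f : nat -> rat^o) :
  (forall i, rat_hom i (f i)) -> \sum_(i < N) f i = 0 ->
  forall i, (i < N)%N -> f i = 0.
Proof.
move=> hf s0 [|i] ltiN; last by case: (hf i.+1).
case: N ltiN s0 => // N _; rewrite big_ord_recl big1 ?addr0 // => i _.
by case: (hf (lift ord0 i)).
Qed.

Fact rat_gcomm m n a b : rat_hom m a -> rat_hom n b ->
  b * a = (-1) ^+ (m * n) * (a * b) :> rat^o.
Proof.
case=> [->|->]; last by rewrite mulr0 mul0r mulr0.
by rewrite mul0n mul1r mulrC.
Qed.

Definition rat_cga : cga :=
  Cga rat_hom0 rat_hom_lin rat_hom1 rat_homM rat_hom_span rat_hom_indep rat_gcomm.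

Fact zero_differential (A : cga) : is_differential (fun _ : A => 0).
Proof.
split=> [c a b|n a _|n a b _|//]; first by rewrite scaler0 addr0.
  exact: hom0.
by rewrite mul0r !mulr0 addr0.
Qed.

Definition Qt (n : nat) : cdga := Cdga (zero_differential (polyext rat_cga n)).

Definition Qt_incl (A : cga) (n : nat) (p : Qt n) : polyext A n :=
  map_mpoly (in_alg A) (p : {mpoly rat[n]}).

(* t_i for i < m, and 0 for m <= i < n. *)
Definition tvar_trunc (A : cga) (m n : nat) (i : 'I_n) : polyext A m :=
  if insub (val i) is Some j then tvar A (j : 'I_m) else 0.

(* The map Q[t_1..t_n] -> Q[t_1..t_m] that models BT^m -> BT^n, the inclusion
   of the first m factors. *)
Definition Qt_proj (m n : nat) (p : Qt n) : Qt m :=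
  mmap (@mpolyC m rat) (fun i => tvar_trunc rat_cga m i : {mpoly rat[m]})
       (p : {mpoly rat[n]}).

(* A KS extension (Q[t_{m+1}..t_n], 0) -> E2 -> E1, with projection p: E2 is
   Q[t_{m+1}..t_n] (x) E1 as a graded algebra over Q[t_{m+1}..t_n], and p is
   the augmentation; D2 t_i = 0 is part of E2 being a KS extension. *)
Definition is_ks_over (A : cdga) (E1 E2 : borel A) (p : {lrmorphism E2 -> E1}) :=
  cdga_morph p /\
  exists h : {lrmorphism polyext E1 (rk E2 - rk E1) -> E2},
    [/\ bijective h, graded h,
        forall (j : 'I_(rk E2 - rk E1)) (i : 'I_(rk E2)),
          i = (rk E1 + j)%N :> nat -> h (tvar E1 j) = tvar A i
      & forall q, p (h q) = aug q].

Definition borel_lt (A : cdga) (E1 E2 : borel A) : Prop :=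
  (rk E1 < rk E2)%N /\
  exists p : {lrmorphism E2 -> E1},
    [/\ is_ks_over p,
        homotopic (A := E2) (B := A) (fun a => aug (p a)) (fun a => aug a)
      & homotopic (A := Qt (rk E2)) (B := E1) (fun a => p (Qt_incl A a))
          (fun a => Qt_incl A (Qt_proj (rk E1) a))].

Definition calX_lt (A : cdga) (Y1 Y2 : calX A) : Prop :=
  exists E1 E2 : borel A, [/\ in_class E1 Y1, in_class E2 Y2 & borel_lt E1 E2].

(* Y lies in X_n and r_0(Y) = k. *)
Definition calX_type (A : cdga) (Y : calX A) (n k : nat) : Prop :=
  exists E : borel A, [/\ in_class E Y, rk E = n & r0 E = k].

Definition calX_sim (A : cdga) (Y1 Y2 : calX A) : Prop :=
  exists n k, calX_type Y1 n k /\ calX_type Y2 n k.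

Definition T0 (A : cdga) : Type := quotient (@calX_sim A).

Definition T0_lt (A : cdga) : T0 A -> T0 A -> Prop :=
  clos_trans (T0 A) (fun P P' => exists Y Y' : calX A,
    [/\ in_class Y P, in_class Y' P' & calX_lt Y Y']).

Definition covers (A : cdga) (P P' : T0 A) : Prop :=
  T0_lt P P' /\ ~ exists P'', T0_lt P P'' /\ T0_lt P'' P'.

Definition edge (A : cdga) (P P' : T0 A) : Prop := covers P P' \/ covers P' P.

(* The element X_Q of X_0, given by (Lambda V, d) itself. *)
Section BasePoint.
Variables (A : cdga) (finA : fin_coh A).

Definition triv_diff (p : polyext A 0) : polyext A 0 := scal 0 (diff (aug p)).

Fact scalK (p : polyext A 0) : scal 0 (aug p) = p.
Proof. exact/esym/nvar0_mpolyC. Qed.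

Fact augK r (a : A) : aug (scal r a) = a.
Proof. by rewrite /aug mcoeffC eqxx mulr1. Qed.

Fact scal_lin (c : rat) (a b : A) :
  scal 0 (c *: a + b) = c *: scal 0 a + scal 0 b.
Proof.
rewrite -[RHS]scalK; congr (scal 0 _).
by rewrite /aug [RHS]mcoeffD [in RHS]mpext_scaleE; congr (_ *: _ + _);
  rewrite mcoeffC eqxx mulr1.
Qed.

Fact aug_lin r (c : rat) (p q : polyext A r) :
  aug (c *: p + q) = c *: aug p + aug q.
Proof. by rewrite /aug mcoeffD mpext_scaleE. Qed.

Fact augM r (p q : polyext A r) : aug (p * q) = aug p * aug q.
Proof. exact: (rmorphM (mcoeff (0%MM : 'X_{1..r}))). Qed.

Fact scalM (a b : A) : scal 0 (a * b) = scal 0 a * scal 0 b.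
Proof. exact: mpolyCM. Qed.

Fact hom_aug r n (p : polyext A r) : hom n p -> hom n (aug p).
Proof.
by case/(_ 0%MM) => [e|[k <-]];
  [rewrite /aug e; apply: hom0 | rewrite mdeg0 addn0].
Qed.

Fact hom_scal r n (a : A) : hom n a -> hom n (scal r a).
Proof.
move=> ha; change (polyext_hom n (scal r a)) => m.
rewrite mcoeffC; case: eqP => [->|_]; last by left; rewrite mulr0.
by right; exists n; rewrite ?mulr1 // mdeg0 addn0.
Qed.

Fact triv_diffP : is_differential triv_diff.
Proof.
have dP := diffP A; rewrite /triv_diff.
split=> [c p q|n p hp|n p q hp|p].
- by rewrite aug_lin (diff_lin dP) scal_lin.
- exact/hom_scal/(diff_deg dP)/hom_aug.
- rewrite augM (diff_leibniz dP _ (hom_aug hp)).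
  rewrite -[in RHS](scalK p) -[in RHS](scalK q) !augK -!scalM.
  rewrite -[diff _ * _]scale1r scal_lin !scale1r; congr (_ + _).
  rewrite -signr_odd mulr_sign -[in RHS]signr_odd mulr_sign.
  by case: ifP => // _; exact: mpolyCN.
- by rewrite augK (diff_sq dP); exact: mpolyC0.
Qed.

Fact triv_tvar (i : 'I_0) : triv_diff (tvar A i) = 0.
Proof. by case: i. Qed.

Fact triv_mod (a : A) : aug (triv_diff (scal 0 a)) = diff a.
Proof. by rewrite /triv_diff !augK. Qed.

Definition triv_ext : ks_ext A 0 := KsExt triv_diffP triv_tvar triv_mod.

Fact triv_fin : fin_coh triv_ext.
Proof.
have [N [z [dz zP]]] := finA; exists N, (fun i => scal 0 (z i)).
split=> [i|p dp].
  by rewrite /= /triv_diff augK dz; exact: mpolyC0.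
have [|c [b eb]] := zP (aug p).
  by rewrite -[LHS](augK 0) -/(triv_diff p) [triv_diff p]dp; exact: mcoeff0.
exists c, (scal 0 b); rewrite -[LHS]scalK eb /= /triv_diff augK.
rewrite addrC -[X in X + _]scale1r scal_lin scale1r addrC; congr (_ + _).
elim/big_rec2: _ => [|i y1 y2 _ <-]; first exact: mpolyC0.
exact: scal_lin.
Qed.

Definition XQ : calX A := class (@borel_iso A) (Borel triv_fin).

Definition P0 : T0 A := class (@calX_sim A) XQ.
End BasePoint.

Record based_graph := BasedGraph {
  vertex : Type;
  adj : vertex -> vertex -> Prop;
  base : vertex
}.

Definition based_graph_iso (G G' : based_graph) : Prop :=
  exists f : vertex G -> vertex G',
    [/\ bijective f, forall u v, adj u v <-> adj (f u) (f v)
      & f (base G) = base G'].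

Definition GH (A : cdga) (finA : fin_coh A) : based_graph :=
  BasedGraph (@edge A) (P0 finA).

(* d.i.(P) = (s, t), with r_0(Y) = r_0(X) - s - t read as an equation in Z. *)
Definition double_index (A : cdga) (P : T0 A) (st : nat * nat) : Prop :=
  exists (Y : calX A) (k : nat),
    [/\ in_class Y P, calX_type Y st.2 k & (k + st.1 + st.2)%N = r0 A].

(* The Hasse diagram drawn in the plane: its set of vertices, and the
   (symmetric) relation of being joined by an edge. *)
Record diagram := Diagram {
  points : nat * nat -> Prop;
  segments : nat * nat -> nat * nat -> Prop
}.

Definition Hasse (A : cdga) : diagram := Diagram
  (fun st => exists P : T0 A, double_index P st)
  (fun st st' => exists P P' : T0 A,
     [/\ double_index P st, double_index P' st' & edge P P']).

(* Main.v *)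
From HB Require Import structures.
From mathcomp Require Import all_boot all_order all_algebra.
From mathcomp Require Import mpoly.
From Stdlib Require Import Relation_Operators ClassicalEpsilon.
From Stdlib Require Import FunctionalExtensionality PropExtensionality.
From Stdlib Require Import ProofIrrelevance.
Require Import Defs.

Set Implicit Arguments.
Unset Strict Implicit.
Unset Printing Implicit Defensive.

Import GRing.Theory.
Local Open Scope ring_scope.

(* Let P = [Y] have level t, where Y is in X_t, and height k = r_0(Y).  Its
   double index is (r_0(X) - t - k, t), so the point is that the based graph
   determines t and k.

   Truncating a model Q[t_1..t_n] (x) Lambda V to its first m variables gives
   elements below it, and a model of an almost free action on a Borel space is
   again a model of an almost free action on X.  So, up to isomorphism,
   Y_1 < Y_2 means that Y_2 extends Y_1 by new variables; this forces
   t + k not to increase along <, every relation Y_1 < Y_2 to factor through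
   level t_1 + 1, every point of positive level to cover one, and every point
   (t, k) of positive height to be covered by (t + 1, k - 1).  So edges change t
   by exactly 1, t is the distance to the base point, and k is the length of a
   longest path along which t increases.

   That r_0 is a maximum at all follows from the Gysin sequence: each variable
   lowers the top degree of the cohomology by one. *)

(** * Linear maps over the rationals *)

Definition linear_fun (U V : lmodType rat) (f : U -> V) : Prop :=
  forall (c : rat) a b, f (c *: a + b) = c *: f a + f b.

Section LinearFun.
Variables (U V : lmodType rat) (f : U -> V).
Hypothesis fL : linear_fun f.

Lemma lf0 : f 0 = 0.
Proof.
have := fL 1 0 0; rewrite !scale1r addr0 => e.
by apply: (addrI (f 0)); rewrite addr0 -e.
Qed.

Lemma lfD a b : f (a + b) = f a + f b.
Proof. by have := fL 1 a b; rewrite !scale1r. Qed.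

Lemma lfZ c a : f (c *: a) = c *: f a.
Proof. by have := fL c a 0; rewrite !addr0 lf0 addr0. Qed.

Lemma lfN a : f (- a) = - f a.
Proof. by rewrite -scaleN1r lfZ scaleN1r. Qed.

Lemma lfB a b : f (a - b) = f a - f b.
Proof. by rewrite lfD lfN. Qed.

Lemma lf_sum (I : Type) (s : seq I) (F : I -> U) :
  f (\sum_(i <- s) F i) = \sum_(i <- s) f (F i).
Proof. by elim/big_rec2: _ => [|i x y _ <-]; rewrite ?lf0 ?lfD. Qed.
End LinearFun.

(** * Graded algebras and their differentials *)

Section Components.
Variable A : cga.
Implicit Types (a b : A) (g : nat -> A).

Lemma homD n a b : hom n a -> hom n b -> hom n (a + b).
Proof. by move=> ha hb; rewrite -[a]scale1r; apply: hom_lin. Qed.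

Lemma homZ n (c : rat) a : hom n a -> hom n (c *: a).
Proof.
by move=> ha; rewrite -[_ *: _]addr0; apply: hom_lin => //; apply: hom0.
Qed.

Lemma homN n a : hom n a -> hom n (- a).
Proof. by move=> ha; rewrite -scaleN1r; apply: homZ. Qed.

Definition decomp a g : Prop :=
  (forall i, hom i (g i)) /\
  exists N, (forall i, (N <= i)%N -> g i = 0) /\ a = \sum_(i < N) g i.

Lemma decomp_sum_widen g N M : (N <= M)%N ->
  (forall i, (N <= i)%N -> g i = 0) -> \sum_(i < N) g i = \sum_(i < M) g i.
Proof.
move=> leNM gN; rewrite (big_ord_widen M g leNM) big_mkcond /=.
by apply: eq_bigr => i _; case: ltnP => // /gN.
Qed.

Lemma decomp_lin (c : rat) a b g g' : decomp a g -> decomp b g' ->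
  decomp (c *: a + b) (fun i => c *: g i + g' i).
Proof.
move=> [hg [N [gN ea]]] [hg' [N' [gN' eb]]]; split=> [i|]; first exact: hom_lin.
exists (N + N')%N; split=> [i lei|].
  by rewrite gN ?gN' ?scaler0 ?addr0 // (leq_trans _ lei) ?leq_addl ?leq_addr.
rewrite ea eb (decomp_sum_widen (leq_addr N' N) gN).
by rewrite (decomp_sum_widen (leq_addl N N') gN') scaler_sumr -big_split.
Qed.

Lemma decomp_exists a : exists g, decomp a g.
Proof.
have [N [f [hf ->]]] := hom_span a.
exists (fun i => if (i < N)%N then f i else 0); split=> [i|].
  by case: ifP => // _; apply: hom0.
exists N; split=> [i|]; first by rewrite ltnNge => ->.
by apply: eq_bigr => i _; rewrite ltn_ord.
Qed.

(** The difference of two decompositions of [a] decomposes 0, and [hom_indep] applies to it. *)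
Lemma decomp_uniq a g g' : decomp a g -> decomp a g' -> g =1 g'.
Proof.
move=> d d' i; have [hh [N [hN e]]] := decomp_lin (-1) d' d.
have [leNi|ltiN] := leqP N i; last first.
  move/esym: e; rewrite scaleN1r addNr => /(hom_indep hh) => /(_ i ltiN) /eqP.
  by rewrite scaleN1r addrC subr_eq0 => /eqP.
by have /eqP := hN i leNi; rewrite scaleN1r addrC subr_eq0 => /eqP.
Qed.

Lemma decomp_hom n a : hom n a -> decomp a (fun i => if i == n then a else 0).
Proof.
move=> ha; split=> [i|]; first by case: eqP => [->|_] //; apply: hom0.
exists n.+1; split=> [i lti|]; first by rewrite gtn_eqF.
rewrite big_ord_recr /= eqxx big1 ?add0r // => i _.
by rewrite ltn_eqF.
Qed.

Definition component (n : nat) a : A :=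
  proj1_sig (constructive_indefinite_description _ (decomp_exists a)) n.

Lemma decomp_component a : decomp a (component^~ a).
Proof. exact: proj2_sig (constructive_indefinite_description _ _). Qed.

Lemma component_hom n a : hom n (component n a).
Proof. by have [] := decomp_component a. Qed.

Lemma component_lin n : linear_fun (component n).
Proof.
move=> c a b.
exact: (decomp_uniq (decomp_component _)
  (decomp_lin c (decomp_component a) (decomp_component b))).
Qed.

Lemma component_of_hom n k a :
  hom k a -> component n a = if n == k then a else 0.
Proof.
by move=> ha; apply: (decomp_uniq (decomp_component _) (decomp_hom ha)).
Qed.

Lemma component_bound a : exists N, forall n, (N <= n)%N -> component n a = 0.
Proof. by have [_ [N [h _]]] := decomp_component a; exists N. Qed.

Lemma component_sum a : exists N, a = \sum_(i < N) component i a.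
Proof. by have [_ [N [_ h]]] := decomp_component a; exists N. Qed.
End Components.

Section Differential.
Variables (A : cga) (D : A -> A).
Hypothesis DP : is_differential D.

Lemma diffL : linear_fun D. Proof. exact: diff_lin DP. Qed.

Lemma diff_1 : D 1 = 0.
Proof.
have := diff_leibniz DP 1 (hom1 A); rewrite !mulr1 !mul1r => e.
by apply: (addrI (D 1)); rewrite addr0 -e.
Qed.

Lemma component_diff n a : component n.+1 (D a) = D (component n a).
Proof.
have [N ea] := component_sum a.
rewrite {1}ea (lf_sum diffL) (lf_sum (component_lin _)).
have step i : component n.+1 (D (component i a)) =
    D (component n (component i a)).
  rewrite (component_of_hom _ (diff_deg DP (component_hom i a))).
  rewrite (component_of_hom _ (component_hom i a)) eqSS.
  by case: ifP => // _; rewrite (lf0 diffL).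
rewrite [in RHS]ea (lf_sum (component_lin _)) (lf_sum diffL).
exact: eq_bigr.
Qed.

Lemma component0_diff a : component 0 (D a) = 0.
Proof.
have [N ->] := component_sum a.
rewrite (lf_sum diffL) (lf_sum (component_lin _)) big1 // => i _.
by rewrite (component_of_hom _ (diff_deg DP (component_hom i a))).
Qed.
End Differential.

(** The form in which simple connectivity enters the arguments below. *)
Definition degree1_trivial (A : cga) : Prop := forall a : A, hom 1 a -> a = 0.

(** The empty word has degree 0 and every other word has degree at least 2, so no word contributes
    to the component of degree 1. *)
Lemma minimal_degree1_trivial (A : cdga) :
  minimal_sullivan A -> degree1_trivial A.
Proof.
move=> [I [deg [x [[hx spanx _] deg2 _ _]]]] a ha.
have [s [_ ea]] := spanx a.
have <- : component 1 a = a by rewrite (component_of_hom _ ha).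
rewrite ea (lf_sum (component_lin _)) big1 // => -[c w] _ /=.
rewrite (lfZ (component_lin _)); case: w => [|i w].
  by rewrite big_nil (component_of_hom _ (hom1 A)) scaler0.
have [k hk] : exists k, hom k (\prod_(j <- w) x j).
  elim: w => [|j w [k hk]]; first by exists 0%N; rewrite big_nil; apply: hom1.
  by exists (deg j + k)%N; rewrite big_cons; apply: homM.
rewrite big_cons (component_of_hom _ (homM (hx i) hk)).
by case: (deg i) (deg2 i) => [|[]] // n _; rewrite scaler0.
Qed.

(** * Polynomial extensions *)

Section PolyextTheory.
Variables (A : cga) (r : nat).
Implicit Types (a b : A) (p q : polyext A r) (m : 'X_{1..r}).

Definition cf p m : A := (p : {mpoly A[r]})@_m.

Definition tmon m : polyext A r := ('X_[m] : {mpoly A[r]}).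

Lemma cfP p q : (forall m, cf p m = cf q m) -> p = q.
Proof. by move=> e; apply/mpolyP. Qed.

Lemma cf_lin m : linear_fun (cf ^~ m).
Proof. by move=> c p q; rewrite /cf mcoeffD mpext_scaleE. Qed.

Lemma scal_linear : linear_fun (@scal A r).
Proof.
move=> c a b; apply: cfP => m.
by rewrite (cf_lin m) /cf !mcoeffC mulrDl scalerAl.
Qed.

Lemma aug_linear : linear_fun (@aug A r). Proof. exact: cf_lin. Qed.

(** With the zero differential, [augK], [augM], [hom_aug] and [hom_scal], stated for a [cdga], apply
    to a [cga]. *)
Let A0 : cdga := Cdga (zero_differential A).

Lemma aug_scal a : aug (scal r a) = a. Proof. exact: (@augK A0). Qed.

Lemma aug_mul p q : aug (p * q) = aug p * aug q.
Proof. exact: (@augM A0). Qed.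

Lemma aug_graded : graded (@aug A r).
Proof. exact: (@hom_aug A0). Qed.

Lemma scal_graded : graded (scal r : A -> polyext A r).
Proof. exact: (@hom_scal A0). Qed.

Lemma scal_mul a b : scal r (a * b) = scal r a * scal r b.
Proof. exact: mpolyCM. Qed.

Lemma scal1 : scal r (1 : A) = 1. Proof. exact: mpolyC1. Qed.

Lemma aug1 : aug (1 : polyext A r) = 1.
Proof. by rewrite -scal1 aug_scal. Qed.

Lemma cf_mon a m k : cf (scal r a * tmon m) k = if m == k then a else 0.
Proof.
by rewrite /cf /scal /tmon mcoeffCM mcoeffX; case: eqP; rewrite ?mulr1 ?mulr0.
Qed.

Lemma aug_mon a m : aug (scal r a * tmon m) = if m == 0%MM then a else 0.
Proof. exact: cf_mon. Qed.

Lemma polyextE p : p = \sum_(m <- msupp p) scal r (cf p m) * tmon m.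
Proof.
by rewrite {1}[p]mpolyE; apply: eq_bigr => m _; rewrite /scal mul_mpolyC.
Qed.

Lemma polyext_ind (P : polyext A r -> Prop) :
  P 0 -> (forall p q, P p -> P q -> P (p + q)) ->
  (forall a m, P (scal r a * tmon m)) -> forall p, P p.
Proof. by move=> P0 PD Pm p; rewrite [p]polyextE; apply: big_ind. Qed.

Lemma tmonC m p : p * tmon m = tmon m * p. Proof. exact: commr_mpolyX. Qed.

Lemma tmonD m k : tmon (m + k) = tmon m * tmon k. Proof. exact: mpolyXD. Qed.

Lemma tmon0 : tmon 0 = 1. Proof. exact: mpolyX0. Qed.

Lemma mon_mul a b m k :
  (scal r a * tmon m) * (scal r b * tmon k) = scal r (a * b) * tmon (m + k).
Proof. by rewrite scal_mul tmonD mulrA -(mulrA (scal r a)) -tmonC !mulrA. Qed.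

Lemma hom_tmon m : hom (mdeg m).*2 (tmon m).
Proof.
move=> k; rewrite mcoeffX; case: eqP => [<-|_]; last by left.
by right; exists 0%N => //; apply: hom1.
Qed.

Lemma hom_tvar (i : 'I_r) : hom 2 (tvar A i).
Proof. by have := hom_tmon U_(i); rewrite mdeg1. Qed.

Lemma hom_cf n p m : hom n p -> hom (n - (mdeg m).*2) (cf p m).
Proof.
move=> /(_ m)[e|[k <- hk]]; last by rewrite addnK.
by rewrite /cf e; apply: hom0.
Qed.

Lemma tmon_ind (P : polyext A r -> Prop) :
  P 1 -> (forall i, P (tvar A i)) -> (forall p q, P p -> P q -> P (p * q)) ->
  forall m, P (tmon m).
Proof.
move=> P1 Pt PM m; rewrite /tmon mpolyXE_id; elim/big_ind: _ => [|p q|i _];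
  [exact: P1 | exact: PM|].
by elim: (m i) => [|k IH]; [exact: P1 | rewrite exprS; apply: PM; [exact: Pt|]].
Qed.

Lemma hom_cfP n p m : hom n p ->
  cf p m = 0 \/ ((mdeg m).*2 <= n)%N.
Proof.
by move=> /(_ m)[e|[k <- _]]; [left | right; rewrite leq_addl].
Qed.

(** The variables have degree 2, so an element of degree 1 only has a constant coefficient, taken
    from [A]. *)
Lemma polyext_degree1 : degree1_trivial A -> degree1_trivial (polyext A r).
Proof.
move=> A1 p hp; apply: cfP => m; rewrite (lf0 (cf_lin m)).
have [//|[k]] := hp m; case: (mdeg m) => [|d]; last by rewrite doubleS !addnS.
by rewrite addn0 => -> /A1.
Qed.

Section Derivation.
Variable D : polyext A r -> polyext A r.
Hypotheses (DP : is_differential D) (Dt : forall i, D (tvar A i) = 0).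

Lemma diff_mulX p m : D (p * tmon m) = D p * tmon m.
Proof.
elim/tmon_ind: (tmon m) p => [p|i p|x y IHx IHy p].
- by rewrite !mulr1.
(* Leibniz needs a homogeneous left factor and [p] is arbitrary, so the central variable is moved to
   the front; its even degree makes the sign trivial. *)
- have tC q : q * tvar A i = tvar A i * q by exact: tmonC.
  rewrite !tC (diff_leibniz DP _ (hom_tvar i)) Dt mul0r add0r.
  by rewrite expr2 mulrNN !mul1r.
- by rewrite !mulrA IHy IHx.
Qed.

Lemma diff_tmon m : D (tmon m) = 0.
Proof. by rewrite -[tmon m]mul1r diff_mulX (diff_1 DP) mul0r. Qed.

(** [D] is linear over the polynomial ring, hence preserves the ideal of the variables and descends
    to the quotient. *)
Lemma aug_diff p : aug (D p) = aug (D (scal r (aug p))).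
Proof.
have DL := diffL DP; elim/polyext_ind: p => [|p q IHp IHq|a m].
- by rewrite (lf0 aug_linear) (lf0 scal_linear).
- rewrite (lfD DL) !(lfD aug_linear) (lfD scal_linear) (lfD DL).
  by rewrite (lfD aug_linear) IHp IHq.
rewrite diff_mulX aug_mon aug_mul -[tmon m]mul1r -scal1 aug_mon.
case: eqP => _; first by rewrite mulr1.
by rewrite mulr0 (lf0 scal_linear) (lf0 DL) (lf0 aug_linear).
Qed.

(** This quotient differential becomes the truncated model in [ks_truncate]. *)
Lemma aug_diff_differential : is_differential (fun a => aug (D (scal r a))).
Proof.
have DL := diffL DP; split=> [c a b|n a ha|n a b ha|a].
- by rewrite scal_linear DL aug_linear.
- exact/aug_graded/(diff_deg DP)/scal_graded.
- rewrite scal_mul (diff_leibniz DP _ (scal_graded ha)) (lfD aug_linear).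
  rewrite aug_mul.
  rewrite aug_scal; congr (_ + _).
  rewrite -[in LHS]signr_odd mulr_sign -[in RHS]signr_odd mulr_sign.
  by case: ifP; rewrite ?(lfN aug_linear) aug_mul aug_scal.
by rewrite -aug_diff (diff_sq DP) (lf0 aug_linear).
Qed.
End Derivation.
End PolyextTheory.

(** * Isomorphisms of graded and differential graded algebras *)

Section AlgebraMorphisms.

Definition alg_morph (A B : algType rat) (f : A -> B) : Prop :=
  [/\ linear_fun f, f 1 = 1 & forall a b, f (a * b) = f a * f b].

Lemma lrmorphism_of (A B : algType rat) (f : A -> B) : alg_morph f ->
  exists F : {lrmorphism A -> B}, F =1 f.
Proof.
move=> [fL f1 fM].
pose l := GRing.isLinear.Build rat A B *:%R f fL.
pose m := GRing.isMonoidMorphism.Build A B f (f1, fM).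
pose F : {lrmorphism A -> B} := HB.pack f l m.
by exists F.
Qed.

Lemma lrmorphism_alg_morph (A B : algType rat) (F : {lrmorphism A -> B}) :
  alg_morph F.
Proof.
by split=> [c a b||a b]; [rewrite linearP | rewrite rmorph1 | rewrite rmorphM].
Qed.

Record gr_iso (A B : cga) (f : A -> B) (g : B -> A) : Prop := GrIso {
  iso_morph : alg_morph f;
  iso_graded : graded f;
  iso_graded_inv : graded g;
  isoK : cancel f g;
  isoKV : cancel g f
}.

Lemma gr_iso_sym (A B : cga) (f : A -> B) g : gr_iso f g -> gr_iso g f.
Proof.
case=> -[fL f1 fM] fG gG fK gK; split=> //; split=> [c a b||a b].
- by apply: (can_inj fK); rewrite fL !gK.
- by apply: (can_inj fK); rewrite f1 gK.
- by apply: (can_inj fK); rewrite fM !gK.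
Qed.

Lemma alg_morph_comp (A B C : algType rat) (f : A -> B) (g : B -> C) :
  alg_morph f -> alg_morph g -> alg_morph (g \o f).
Proof.
by move=> [fL f1 fM] [gL g1 gM]; split=> [c a b||a b] /=;
  rewrite ?fL ?gL ?f1 ?g1 ?fM ?gM.
Qed.

Lemma graded_comp (A B C : cga) (f : A -> B) (g : B -> C) :
  graded f -> graded g -> graded (g \o f).
Proof. by move=> fG gG n a ha; apply/gG/fG. Qed.

Lemma gr_iso_comp (A B C : cga) (f : A -> B) g (f' : B -> C) g' :
  gr_iso f g -> gr_iso f' g' -> gr_iso (f' \o f) (g \o g').
Proof.
move=> [fm fG gG fK gK] [fm' fG' gG' fK' gK']; split.
- exact: alg_morph_comp.
- exact: graded_comp.
- exact: graded_comp.
- exact: can_comp.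
- exact: can_comp.
Qed.

(** The point is that the inverse is graded: [F] sends components to components, so [g b] has the
    components of [b] pulled back. *)
Lemma gr_iso_of_bijective (A B : cga) (F : {lrmorphism A -> B}) :
  bijective F -> graded F -> exists g, gr_iso F g.
Proof.
move=> [g FK gK] FG; exists g; split=> //; first exact: lrmorphism_alg_morph.
move=> n b hb; have [L _ _] := lrmorphism_alg_morph F.
have e k : F (component k (g b)) = component k b.
  have [N en] := component_sum (g b).
  rewrite -{2}[b]gK {2}en (lf_sum L) (lf_sum (component_lin _)).
  rewrite {1}en (lf_sum (component_lin _)) (lf_sum L); apply: eq_bigr => i _.
  rewrite (component_of_hom _ (FG _ _ (component_hom i (g b)))).
  rewrite (component_of_hom _ (component_hom i (g b))).
  by case: ifP => // _; rewrite (lf0 L).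
have -> : g b = component n (g b).
  by apply: (can_inj FK); rewrite gK e (component_of_hom _ hb) eqxx.
exact: component_hom.
Qed.

Lemma cdga_isoP (A B : cdga) : cdga_iso A B <->
  exists (f : A -> B) (g : B -> A),
    gr_iso f g /\ forall a, f (diff a) = diff (f a).
Proof.
split=> [[F [bF [FG Fd]]]|[f [g [fI fd]]]].
  by have [g FI] := gr_iso_of_bijective bF FG; exists F, g.
have [F FE] := lrmorphism_of (iso_morph fI); exists F; split; first last.
  by split=> [n a ha|a]; rewrite !FE; [apply: (iso_graded fI) | apply: fd].
by exists g => a; rewrite ?FE; [apply: (isoK fI) | apply: (isoKV fI)].
Qed.

Lemma cdga_iso_refl (A : cdga) : cdga_iso A A.
Proof. by apply/cdga_isoP; exists id, id; do !split. Qed.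

Lemma cdga_iso_sym (A B : cdga) : cdga_iso A B -> cdga_iso B A.
Proof.
move=> /cdga_isoP[f [g [fI fd]]]; apply/cdga_isoP; exists g, f.
split=> [|b]; first exact: gr_iso_sym.
by apply: (can_inj (isoK fI)); rewrite fd !(isoKV fI).
Qed.

Lemma cdga_iso_trans (A B C : cdga) :
  cdga_iso A B -> cdga_iso B C -> cdga_iso A C.
Proof.
move=> /cdga_isoP[f [g [fI fd]]] /cdga_isoP[f' [g' [fI' fd']]].
apply/cdga_isoP; exists (f' \o f), (g \o g'); split=> [|a /=].
  exact: gr_iso_comp.
by rewrite fd fd'.
Qed.

Lemma fin_coh_iso (A B : cdga) : cdga_iso A B -> fin_coh A -> fin_coh B.
Proof.
move=> /cdga_iso_sym/cdga_isoP[g [f [gI gd]]].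
have fI := gr_iso_sym gI.
have [[fL _ _] [gL _ _]] := (iso_morph fI, iso_morph gI).
have fd a : f (diff a) = diff (f a).
  by apply: (can_inj (isoK gI)); rewrite gd !(isoK fI).
move=> [N [z [dz zP]]]; exists N, (f \o z); split=> [i|b db] /=.
  by rewrite -fd dz (lf0 fL).
have [|c [a ea]] := zP (g b); first by rewrite -gd db (lf0 gL).
exists c, (f a); rewrite -fd -[b](isoK gI) ea (lfD fL) (lf_sum fL).
by congr (_ + _); apply: eq_bigr => i _; rewrite (lfZ fL).
Qed.

Section TransportDifferential.
Variables (A B : cga) (f : A -> B) (g : B -> A) (D : A -> A).
Hypotheses (fI : gr_iso f g) (DP : is_differential D).

Lemma transport_differential : is_differential (fun b => f (D (g b))).
Proof.
have [fL f1 fM] := iso_morph fI; have [gL g1 gM] := iso_morph (gr_iso_sym fI).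
split=> [c a b|n a ha|n a b ha|a].
- by rewrite gL (diffL DP) fL.
- exact/(iso_graded fI)/(diff_deg DP)/(iso_graded_inv fI).
- rewrite gM (diff_leibniz DP _ (iso_graded_inv fI ha)) (lfD fL) fM.
  rewrite (isoKV fI); congr (_ + _).
  rewrite -[in LHS]signr_odd mulr_sign -[in RHS]signr_odd mulr_sign.
  by case: ifP; rewrite ?(lfN fL) fM (isoKV fI).
- by rewrite (isoK fI) (diff_sq DP) (lf0 fL).
Qed.
End TransportDifferential.
End AlgebraMorphisms.

Section PolyextMap.
Variables (A B : cga) (r : nat) (f : A -> B) (g : B -> A).
Hypothesis fI : gr_iso f g.

Lemma polyext_iso : exists (F : polyext A r -> polyext B r) G,
  [/\ gr_iso F G, forall p m, cf (F p) m = f (cf p m)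
    & forall q m, cf (G q) m = g (cf q m)].
Proof.
have [h hE] := lrmorphism_of (iso_morph fI).
have [k kE] := lrmorphism_of (iso_morph (gr_iso_sym fI)).
pose F (p : polyext A r) : polyext B r := map_mpoly h (p : {mpoly A[r]}).
pose G (p : polyext B r) : polyext A r := map_mpoly k (p : {mpoly B[r]}).
have FE p m : cf (F p) m = f (cf p m).
  by rewrite /cf /F mcoeff_map_mpoly; apply: hE.
have GE p m : cf (G p) m = g (cf p m).
  by rewrite /cf /G mcoeff_map_mpoly; apply: kE.
have [[fL _ _] [gL _ _]] := (iso_morph fI, iso_morph (gr_iso_sym fI)).
exists F, G; split=> //; split.
- split=> [c p q||p q].
  + by apply: cfP => m; rewrite (cf_lin m) !FE (cf_lin m) fL.
  + exact: (rmorph1 (map_mpoly h)).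
  + exact: (rmorphM (map_mpoly h)).
- move=> n p hp m; rewrite [X in coef_hom _ _ X]FE.
  have [e|[j <- hj]] := hp m; first by left; rewrite /cf e (lf0 fL).
  by right; exists j => //; apply: (iso_graded fI).
- move=> n p hp m; rewrite [X in coef_hom _ _ X]GE.
  have [e|[j <- hj]] := hp m.
    by left; rewrite /cf e (lf0 gL).
  by right; exists j => //; apply: (iso_graded_inv fI).
- by move=> p; apply: cfP => m; rewrite GE FE (isoK fI).
- by move=> p; apply: cfP => m; rewrite FE GE (isoKV fI).
Qed.
End PolyextMap.

(** * KS extensions *)

Section KSBaseChange.

Lemma cf_tvar (A : cga) r (i : 'I_r) (m : 'X_{1..r}) :
  cf (tvar A i) m = if U_(i)%MM == m then 1 else 0.
Proof. by rewrite /cf /tvar mcoeffX; case: eqP. Qed.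

Lemma cf_scal (A : cga) r (a : A) (m : 'X_{1..r}) :
  cf (scal r a) m = if m == 0%MM then a else 0.
Proof. by rewrite /cf /scal mcoeffC; case: eqP; rewrite ?mulr1 ?mulr0. Qed.

(** The isomorphism is extended coefficientwise to the polynomial algebras and the differential is
    conjugated by it. *)
Lemma ks_ext_iso (A B : cdga) r (E : ks_ext A r) : cdga_iso A B ->
  exists E' : ks_ext B r, cdga_iso E E'.
Proof.
move=> /cdga_isoP[f [g [fI fd]]].
have [[fL f1 _] [gL g1 _]] := (iso_morph fI, iso_morph (gr_iso_sym fI)).
have [F [G [FI FE GE]]] := polyext_iso r fI.
have DP := transport_differential FI (ks_diffP E).
have Dt i : F (ks_diff E (G (tvar B i))) = 0.
  have -> : G (tvar B i) = tvar A i.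
    apply: cfP => m; rewrite GE !cf_tvar.
    by case: ifP; rewrite ?g1 // (lf0 gL).
  by rewrite ks_tvar; have [FL _ _] := iso_morph FI; rewrite (lf0 FL).
have Dm b : aug (F (ks_diff E (G (scal r b)))) = diff b.
  have -> : G (scal r b) = scal r (g b).
    by apply: cfP => m; rewrite GE !cf_scal; case: ifP; rewrite // (lf0 gL).
  rewrite -[LHS]/(cf _ 0%MM) FE -[cf _ _]/(aug _) ks_mod fd.
  by rewrite (isoKV fI).
exists (KsExt DP Dt Dm); apply/cdga_isoP; exists F, G; split=> // a /=.
by rewrite (isoK FI).
Qed.

Lemma toral_rank_ge_iso (A B : cdga) r :
  cdga_iso A B -> toral_rank_ge A r -> toral_rank_ge B r.
Proof.
move=> iAB [E finE]; have [E' iE] := ks_ext_iso E iAB.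
by exists E'; apply: fin_coh_iso iE finE.
Qed.
End KSBaseChange.

(** * Splitting the variables into old and new ones *)

Section SplitMonomials.
Variables m k : nat.
Implicit Types (c : 'X_{1..m + k}) (a : 'X_{1..m}) (b : 'X_{1..k}).

(* A monomial in m + k variables as a pair of monomials; psplit and pjoin below
   are Q[t_1..t_{m+k}] (x) A = Q[t_{m+1}..t_{m+k}] (x) (Q[t_1..t_m] (x) A). *)
Definition mnm_l c : 'X_{1..m} := [multinom c (lshift k i) | i < m].
Definition mnm_r c : 'X_{1..k} := [multinom c (rshift m j) | j < k].
Definition mnm_join a b : 'X_{1..m + k} :=
  [multinom (match split i with inl j => a j | inr j => b j end) | i < m + k].

Lemma mnm_joinl a b : mnm_l (mnm_join a b) = a.
Proof.
apply/mnmP=> i; rewrite !mnmE -[lshift k i]/(unsplit (inl i)).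
by rewrite unsplitK.
Qed.

Lemma mnm_joinr a b : mnm_r (mnm_join a b) = b.
Proof.
apply/mnmP=> i; rewrite !mnmE -[rshift m i]/(unsplit (inr i)).
by rewrite unsplitK.
Qed.

Lemma mnm_lrK c : mnm_join (mnm_l c) (mnm_r c) = c.
Proof.
apply/mnmP=> i; rewrite mnmE; case: splitP => j e; rewrite mnmE;
  by congr (c _); apply: val_inj.
Qed.

Lemma mnm_join_eq c a b :
  (c == mnm_join a b) = (mnm_l c == a) && (mnm_r c == b).
Proof.
apply/eqP/andP => [->|[/eqP <- /eqP <-]]; last by rewrite mnm_lrK.
by rewrite mnm_joinl mnm_joinr !eqxx.
Qed.

Lemma mdeg_lr c : mdeg c = (mdeg (mnm_l c) + mdeg (mnm_r c))%N.
Proof.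
rewrite !mdegE big_split_ord /=.
by congr (_ + _)%N; apply: eq_bigr => i _; rewrite mnmE.
Qed.

Lemma mnm_lD c c' : mnm_l (c + c') = (mnm_l c + mnm_l c')%MM.
Proof. by apply/mnmP=> i; rewrite !mnmE. Qed.

Lemma mnm_rD c c' : mnm_r (c + c') = (mnm_r c + mnm_r c')%MM.
Proof. by apply/mnmP=> i; rewrite !mnmE. Qed.

Lemma mnm_join0 : mnm_join 0 0 = 0%MM.
Proof. by apply/mnmP=> i; rewrite mnmE; case: split => j; rewrite !mnmE. Qed.

Lemma mnm_join_Ul i : mnm_join U_(i) 0 = U_(lshift k i)%MM.
Proof.
apply/esym/eqP; rewrite mnm_join_eq; apply/andP; split; apply/eqP/mnmP=> j.
  by rewrite !mnmE (inj_eq (@lshift_inj _ _)).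
by rewrite !mnmE eq_lrshift.
Qed.

Lemma mnm_join_Ur j : mnm_join 0 U_(j) = U_(rshift m j)%MM.
Proof.
apply/esym/eqP; rewrite mnm_join_eq; apply/andP; split; apply/eqP/mnmP=> i.
  by rewrite !mnmE eq_rlshift.
by rewrite !mnmE (inj_eq (@rshift_inj _ _)).
Qed.
End SplitMonomials.

Section SplitPolyext.
Variables (A : cga) (m k : nat).
Implicit Types (p : polyext A (m + k)) (q : polyext (polyext A m) k).

Definition psplit p : polyext (polyext A m) k :=
  \sum_(c <- msupp p)
     scal k (scal m (cf p c) * tmon A (mnm_l c)) * tmon (polyext A m) (mnm_r c).

Definition pjoin q : polyext A (m + k) :=
  \sum_(b <- msupp q) \sum_(a <- msupp (cf q b))
     scal (m + k) (cf (cf q b) a) * tmon A (mnm_join a b).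

Lemma cf_if (B : cga) r (t : bool) (p : polyext B r) c :
  cf (if t then p else 0) c = if t then cf p c else 0.
Proof. by case: t; rewrite // (lf0 (cf_lin c)). Qed.

Lemma cf_sum (B : cga) r (I : Type) (s : seq I) (F : I -> polyext B r) c :
  cf (\sum_(i <- s) F i) c = \sum_(i <- s) cf (F i) c.
Proof. by rewrite (lf_sum (cf_lin c)). Qed.

Lemma sum_msupp (B : cga) r (p : polyext B r) (c : 'X_{1..r}) :
  \sum_(b <- msupp p) (if b == c then cf p b else 0) = cf p c.
Proof.
rewrite [in RHS](polyextE p) cf_sum.
by apply: eq_bigr => b _; rewrite cf_mon.
Qed.

Lemma cf_psplit p b a : cf (cf (psplit p) b) a = cf p (mnm_join a b).
Proof.
rewrite /psplit !cf_sum -sum_msupp; apply: eq_bigr => c _.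
by rewrite cf_mon mnm_join_eq andbC cf_if cf_mon; case: eqP.
Qed.

Lemma cf_pjoin q c : cf (pjoin q) c = cf (cf q (mnm_r c)) (mnm_l c).
Proof.
rewrite /pjoin cf_sum -[in RHS](sum_msupp q (mnm_r c)) cf_sum.
apply: eq_bigr => b _; rewrite cf_sum; case: eqP => [->|ne].
  rewrite -[in RHS]sum_msupp; apply: eq_bigr => a _.
  by rewrite cf_mon eq_sym mnm_join_eq eqxx andbT eq_sym.
rewrite (lf0 (cf_lin _)) big1 // => a _.
by rewrite cf_mon eq_sym mnm_join_eq andbC eq_sym; case: eqP.
Qed.

Lemma psplit_iso : gr_iso psplit pjoin.
Proof.
have eP q q' : (forall b a, cf (cf q b) a = cf (cf q' b) a) -> q = q'.
  by move=> e; apply: cfP => b; apply: cfP.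
have sL : linear_fun psplit.
  by move=> c p p'; apply: eP => b a; rewrite !(cf_psplit, cf_lin).
have sM a c : psplit (scal _ a * tmon A c) =
    scal k (scal m a * tmon A (mnm_l c)) * tmon (polyext A m) (mnm_r c).
  apply: eP => b' a'; rewrite cf_psplit !cf_mon mnm_join_eq andbC.
  by rewrite cf_if cf_mon; case: eqP.
split; first split=> //.
- rewrite -(scal1 A) -(scal1 (polyext A m)) -(scal1 A).
  apply: eP => b a; rewrite cf_psplit !cf_scal -[X in _ == X]mnm_join0 eq_sym.
  rewrite mnm_join_eq mnm_joinl mnm_joinr andbC (eq_sym _ a) (eq_sym _ b).
  by rewrite cf_if cf_scal; case: eqP.
- move=> p p'; elim/polyext_ind: p => [|p q IHp IHq|a c].
  + by rewrite mul0r (lf0 sL) mul0r.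
  + by rewrite mulrDl !(lfD sL) IHp IHq mulrDl.
  elim/polyext_ind: p' => [|p q IHp IHq|a' c'].
  + by rewrite mulr0 (lf0 sL) mulr0.
  + by rewrite mulrDr !(lfD sL) IHp IHq mulrDr.
  by rewrite mon_mul !sM !mon_mul mnm_lD mnm_rD.
- move=> n p hp b.
  have e a : cf (cf (psplit p) b) a = 0 \/ (exists2 j,
      (j + (mdeg a).*2 + (mdeg b).*2)%N = n & hom j (cf (cf (psplit p) b) a)).
    rewrite cf_psplit; have [z|[j <- hj]] := hp (mnm_join a b); first by left.
    right; exists j => //.
    by rewrite mdeg_lr mnm_joinl mnm_joinr doubleD addnA.
  (* The inner degree [n - (mdeg b).*2] is a truncated subtraction; when [(mdeg b).*2] exceeds [n]
     the coefficient at [b] has to vanish. *)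
  have [leb|ltb] := leqP (mdeg b).*2 n.
    right; exists (n - (mdeg b).*2)%N; first by rewrite subnK.
    move=> a; have [z|[j <- hj]] := e a; first by left.
    by right; exists j; rewrite // addnK.
  left; apply: cfP => a; rewrite (lf0 (cf_lin _)).
  have [//|[j ej _]] := e a.
  by move: ltb; rewrite -ej ltnNge leq_addl.
- move=> n q hq c; rewrite [X in coef_hom _ _ X]cf_pjoin.
  have [eb|[j <- hj]] := hq (mnm_r c).
    by left; rewrite /cf eb mcoeff0.
  have [ea|[i <- hi]] := hj (mnm_l c); first by left.
  by right; exists i => //; rewrite mdeg_lr doubleD addnA.
- by move=> p; apply: cfP => c; rewrite cf_pjoin cf_psplit mnm_lrK.
- by move=> q; apply: eP => b a; rewrite cf_psplit cf_pjoin mnm_joinl mnm_joinr.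
Qed.

Lemma pjoin_scal a : pjoin (scal k (scal m a)) = scal (m + k) a.
Proof.
apply: cfP => c; rewrite cf_pjoin !cf_scal -(mnm_join0 m k) mnm_join_eq.
by rewrite andbC cf_if cf_scal; case: eqP.
Qed.

Lemma pjoin_tvarl i : pjoin (scal k (tvar A i)) = tvar A (lshift k i).
Proof.
apply: cfP => c; rewrite cf_pjoin cf_scal cf_tvar -mnm_join_Ul [in RHS]eq_sym.
rewrite mnm_join_eq andbC.
by rewrite cf_if cf_tvar (eq_sym U_(i)%MM); case: eqP.
Qed.

Lemma pjoin_tvarr j : pjoin (tvar (polyext A m) j) = tvar A (rshift m j).
Proof.
apply: cfP => c; rewrite cf_pjoin !cf_tvar -mnm_join_Ur.
rewrite [in RHS]eq_sym mnm_join_eq andbC cf_if -scal1 cf_scal.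
by rewrite (eq_sym U_(j)%MM); case: eqP.
Qed.
End SplitPolyext.

(** * Truncation and composition of KS extensions *)

Section TruncateCompose.
Variables (A : cdga) (m k : nat).

Lemma aug_aug_psplit (p : polyext A (m + k)) : aug (aug (psplit p)) = aug p.
Proof. by rewrite /aug -!/(cf _ _) cf_psplit mnm_join0. Qed.

(** Read on the split algebra, the differential kills the [k] new variables, so it descends modulo
    them to [E']; [F] is the same differential seen as an extension of [E'], which makes its last
    field hold by definition. *)
Lemma ks_truncate (E : ks_ext A (m + k)) :
  exists (E' : ks_ext A m) (F : ks_ext E' k), cdga_iso F E.
Proof.
have sI := psplit_iso A m k; have [sL _ _] := iso_morph sI.
have DP := transport_differential sI (ks_diffP E).
have Dt j : psplit (ks_diff E (pjoin (tvar (polyext A m) j))) = 0.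
  by rewrite pjoin_tvarr ks_tvar (lf0 sL).
have dt i : aug (psplit (ks_diff E (pjoin (scal k (tvar A i))))) = 0.
  by rewrite pjoin_tvarl ks_tvar (lf0 sL) (lf0 (@aug_linear _ _)).
have dm a : aug (aug (psplit (ks_diff E (pjoin (scal k (scal m a)))))) = diff a.
  by rewrite pjoin_scal aug_aug_psplit ks_mod.
pose E' := KsExt (aug_diff_differential DP Dt) dt dm.
pose F : ks_ext E' k := @KsExt E' k _ DP Dt (fun=> erefl).
exists E', F; apply/cdga_isoP; exists (@pjoin A m k), (@psplit A m k).
by split=> [|q]; [apply: gr_iso_sym | rewrite /= (isoKV (gr_iso_sym sI))].
Qed.

(* D t_i (i <= m) has degree 3 and lies in the ideal of the k new variables,
   whose degree 3 part involves A^1; so A^1 = 0 is what keeps the old variables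
   cocycles. *)
Lemma ks_compose (E : ks_ext A m) (F : ks_ext E k) : degree1_trivial A ->
  exists G : ks_ext A (m + k),
    forall q, ks_diff G (pjoin q) = pjoin (ks_diff F q).
Proof.
move=> A1; have jI := gr_iso_sym (psplit_iso A m k).
have [jL _ _] := iso_morph jI.
have DP := transport_differential jI (ks_diffP F).
have Ft i : ks_diff F (scal k (tvar A i)) = 0.
  have h3 := diff_deg (ks_diffP F) (scal_graded (hom_tvar A i)).
  apply: cfP => b; rewrite (lf0 (cf_lin _)).
  have [->|ne0] := eqVneq b 0%MM.
    by rewrite -[LHS]/(aug _) ks_mod; apply: ks_tvar.
  have [//|] := hom_cfP b h3; rewrite -mdeg_eq0 in ne0.
  have := hom_cf b h3; case: (mdeg b) ne0 => [|[|d]] // _ h1 _.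
  exact: (polyext_degree1 A1 h1).
have Dt (i : 'I_(m + k)) : pjoin (ks_diff F (psplit (tvar A i))) = 0.
  by case: (split_ordP i) => j ->;
    rewrite -?pjoin_tvarl -?pjoin_tvarr (isoK jI) ?Ft ?ks_tvar (lf0 jL).
have Dm a : aug (pjoin (ks_diff F (psplit (scal (m + k) a)))) = diff a.
  rewrite -aug_aug_psplit (isoK jI) -pjoin_scal (isoK jI).
  by rewrite (ks_mod F (scal m a) : aug (ks_diff F _) = ks_diff E _) ks_mod.
by exists (KsExt DP Dt Dm) => q /=; rewrite (isoK jI).
Qed.
End TruncateCompose.

Section ConstantHomotopy.

(** The constant homotopy, free of [u] and [du]. It suffices for the projections built below, whose
    compatibility squares commute strictly. *)
Lemma homotopic_ext (A B : cdga) (f g : A -> B) :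
  alg_morph f -> graded f -> (forall a, f (diff a) = diff (f a)) -> f =1 g ->
  homotopic f g.
Proof.
move=> [fL f1 fM] fG fd fg.
have dL := diffL (diffP B).
exists (fun a => (f a)%:P), (fun=> 0).
do !split.
- by move=> c a b; rewrite fL polyCD -mul_polyC -polyCM mulr_algl.
- by move=> c a b; rewrite scaler0 addr0.
- by rewrite f1.
- by move=> a b; rewrite fM polyCM.
- by move=> n a b _; rewrite mulr0 mul0r mulr0 addr0.
- by move=> n a ha j; rewrite coefC; case: eqP => _; [apply: fG | apply: hom0].
- by move=> n a _ j; rewrite coef0; apply: hom0.
- by move=> a j; rewrite fd !coefC; case: eqP => _ //; rewrite (lf0 dL).
- by move=> n a _ j; rewrite derivC !coef0 (lf0 dL) mulr0 addr0.
- by move=> a; rewrite hornerC.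
- by move=> a; rewrite hornerC fg.
Qed.
End ConstantHomotopy.

Section QtMaps.

Lemma cf_Qt_incl (A : cga) n (q : Qt n) (c : 'X_{1..n}) :
  cf (Qt_incl A q) c = (cf q c : rat)%:A.
Proof. by rewrite /cf /Qt_incl mcoeff_map_mpoly. Qed.

Lemma cf_Qt_proj m k (q : Qt (m + k)) (a : 'X_{1..m}) :
  cf (Qt_proj m q) a = cf q (mnm_join a 0).
Proof.
have PD (p p' : Qt (m + k)) : Qt_proj m (p + p') = Qt_proj m p + Qt_proj m p'.
  exact: raddfD.
elim/polyext_ind: q => [|p q IHp IHq|c e].
- have -> : Qt_proj m (0 : Qt (m + k)) = 0 by exact: raddf0.
  by rewrite !(lf0 (cf_lin _)).
- by rewrite PD !(lfD (cf_lin _)) IHp IHq.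
rewrite cf_mon mnm_join_eq /Qt_proj /scal /tmon mul_mpolyC mmapZ mmapX.
rewrite /mmap1 big_split_ord /=.
have -> : \prod_(i < m) tvar_trunc rat_cga m (lshift k i) ^+ e (lshift k i)
    = 'X_[mnm_l e] :> {mpoly rat[m]}.
  rewrite mpolyXE_id; apply: eq_bigr => i _.
  by rewrite mnmE /tvar_trunc /= (valK i).
(* The last [k] variables go to 0 and [0 ^+ 0 = 1], so this product tests whether the monomial
   avoids them. *)
have -> : \prod_(j < k) tvar_trunc rat_cga m (rshift m j) ^+ e (rshift m j)
    = (mnm_r e == 0%MM)%:R :> {mpoly rat[m]}.
  case: eqP => [e0|/eqP ne0].
    rewrite big1 // => j _; move/mnmP/(_ j): e0; rewrite !mnmE => ->.
    by rewrite expr0.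
  have /existsP[j nej] : [exists j, mnm_r e j != 0%N].
    apply: contraNT ne0; rewrite negb_exists => /forallP z.
    by apply/eqP/mnmP => j; rewrite mnm0E; apply/eqP/negPn.
  rewrite (bigD1 j) //= [X in X ^+ _]/tvar_trunc insubF; last first.
    by rewrite /= ltnNge leq_addr.
  by rewrite expr0n; rewrite mnmE in nej; rewrite (negPf nej) mul0r.
rewrite mulrA mulr_natr /cf mcoeffMn mul_mpolyC mcoeffZ mcoeffX.
by case: eqP; case: eqP; rewrite ?mulr1 ?mulr0.
Qed.

Lemma Qt_incl_morph (A : cga) n : alg_morph (@Qt_incl A n).
Proof.
split=> [c p q||p q].
- apply: cfP => e; rewrite (cf_lin _) !cf_Qt_incl (cf_lin _).
  by rewrite scalerDl scalerA.
- exact: (rmorph1 (map_mpoly (in_alg A))).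
- exact: (rmorphM (map_mpoly (in_alg A))).
Qed.

Lemma Qt_incl_graded (A : cga) n : graded (@Qt_incl A n).
Proof.
move=> d q hq e; rewrite [X in coef_hom _ _ X]cf_Qt_incl.
have [z|[j <- [->|z]]] := hq e.
- by left; rewrite /cf z scale0r.
- right; exists 0%N => //; exact/homZ/hom1.
- by left; rewrite /cf z scale0r.
Qed.

Lemma ks_diff_Qt_incl (A : cdga) n (E : ks_ext A n) (q : Qt n) :
  ks_diff E (Qt_incl A q) = 0.
Proof.
have DL := diffL (ks_diffP E); have [iL _ iM] := Qt_incl_morph A n.
elim/polyext_ind: q => [|p q IHp IHq|c e].
- by rewrite (lf0 iL) (lf0 DL).
- by rewrite (lfD iL) (lfD DL) IHp IHq addr0.
have -> : Qt_incl A (scal n c * tmon rat_cga e : Qt n) = (c : rat) *: tmon A e.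
  apply: cfP => e'; rewrite cf_Qt_incl cf_mon (lfZ (cf_lin _)).
  rewrite /cf /tmon mcoeffX; case: eqP => _; rewrite ?scaler0 ?scale0r //.
by rewrite (lfZ DL) (diff_tmon (ks_diffP E) (@ks_tvar _ _ E)) scaler0.
Qed.
End QtMaps.

(** * The order on models of Borel spaces as extension by new variables *)

Section BorelOrder.

(** [K] stands for [m + k - m], the number of new variables in [is_ks_over], which equals [k] only
    propositionally. *)
Lemma pjoin_lrmorphism (A : cga) m k K : K = k ->
  exists h : {lrmorphism polyext (polyext A m) K -> polyext A (m + k)},
    [/\ bijective h, graded h,
        forall (j : 'I_K) (i : 'I_(m + k)), i = (m + j)%N :> nat ->
          h (tvar (polyext A m) j) = tvar A i
      & forall q, aug (psplit (h q)) = aug q].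
Proof.
move=> ->; have jI := gr_iso_sym (psplit_iso A m k).
have [h hE] := lrmorphism_of (iso_morph jI); exists h; split.
- by exists (@psplit A m k) => x; rewrite hE;
    [apply: (isoK jI) | apply: (isoKV jI)].
- by move=> n q hq; rewrite hE; apply: (iso_graded jI).
- move=> j i e; rewrite hE pjoin_tvarr; congr (tvar A _).
  by apply: val_inj; rewrite /= e.
- by move=> q; rewrite hE (isoK jI).
Qed.

(** [ks_compose] regards the extension as a model over [A]; the projection to [E] is [psplit]
    followed by setting the new variables to 0. *)
Lemma borel_extend (A : cdga) (E : borel A) k (F : ks_ext E k) :
  degree1_trivial A -> (0 < k)%N -> fin_coh F ->
  exists G : borel A, [/\ rk G = (rk E + k)%N, cdga_iso G F & borel_lt E G].
Proof.
case: E F => m E finE F A1 k0 finF.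
have [G GE] := ks_compose F A1.
have sI := psplit_iso A m k; have jI := gr_iso_sym sI.
have GE' p : psplit (ks_diff G p) = ks_diff F (psplit p).
  by rewrite -{1}[p](isoK sI) GE (isoKV sI).
have iFG : cdga_iso F G.
  apply/cdga_isoP; exists (@pjoin A m k), (@psplit A m k).
  by split=> // q; rewrite [RHS]GE.
have finG := fin_coh_iso iFG finF.
exists (Borel finG); split=> //; first exact: cdga_iso_sym.
split; first by rewrite /= -addn1 leq_add2l.
have augM' : alg_morph (@aug (polyext A m) k).
  by split; [apply: aug_linear | apply: aug1 | apply: aug_mul].
have pM : alg_morph (fun q : polyext A (m + k) => aug (psplit q)).
  exact: (alg_morph_comp (iso_morph sI) augM').
have pG : graded (fun q : polyext A (m + k) => aug (psplit q)).
  by move=> n q hq; apply/aug_graded/(iso_graded sI).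
have pd q : aug (psplit (ks_diff G q)) = ks_diff E (aug (psplit q)).
  rewrite GE' (aug_diff (ks_diffP F) (@ks_tvar _ _ F)).
  exact: (ks_mod F (aug (psplit q))).
have [p pE] := lrmorphism_of pM.
have pGr : cdga_morph (p : {lrmorphism Borel finG -> Borel finE}).
  split=> [n q hq|q]; first by rewrite pE; apply: pG.
  by rewrite [LHS]pE; apply: etrans (pd q) _; rewrite -pE.
exists p; split.
- split=> //; have [h [hB hG ht hp]] := pjoin_lrmorphism A m (addKn m k).
  by exists h; split=> // q; rewrite pE; apply: hp.
- have aM r : alg_morph (@aug A r).
    by split; [apply: aug_linear | apply: aug1 | apply: aug_mul].
  have e q : aug (p q) = aug q by rewrite pE aug_aug_psplit.
  apply: homotopic_ext => //.
  + by have [L M1 MM] := aM (m + k)%N; split=> [c a b||a b]; rewrite !e.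
  + by move=> n q hq; rewrite e; apply: aug_graded.
  + move=> q; rewrite !e [LHS](aug_diff (ks_diffP G) (@ks_tvar _ _ G)).
    exact: ks_mod.
- have pI q : p (Qt_incl A q) = Qt_incl A (Qt_proj m q).
    rewrite pE; apply: cfP => a; rewrite cf_Qt_incl cf_Qt_proj -cf_Qt_incl.
    exact: cf_psplit.
  apply: homotopic_ext => //.
  + exact: (alg_morph_comp (Qt_incl_morph A _) (lrmorphism_alg_morph p)).
  + by move=> n q hq; apply: (pGr.1); apply: Qt_incl_graded.
  + move=> q; have z : ks_diff E (p (Qt_incl A q)) = 0.
      by rewrite pI; apply: ks_diff_Qt_incl.
    rewrite [RHS]z [diff q]/=.
    have [iL _ _] := Qt_incl_morph A (m + k).
    have [pL _ _] := lrmorphism_alg_morph p.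
    by rewrite (lf0 iL) (lf0 pL).
Qed.

(** The differential of [G] is transported along [h]. It reduces to that of [E] because [p] commutes
    with the differentials and [p] after [h] is the augmentation. *)
Lemma ks_ext_of_projection (A : cdga) m n k (E : ks_ext A m) (G : ks_ext A n)
    (p : polyext A n -> polyext A m)
    (h : {lrmorphism polyext (polyext A m) k -> polyext A n}) :
  (forall a, p (ks_diff G a) = ks_diff E (p a)) -> bijective h -> graded h ->
  (forall j : 'I_k, exists i, h (tvar (polyext A m) j) = tvar A i) ->
  (forall q, p (h q) = aug q) ->
  exists F : ks_ext E k, cdga_iso G F.
Proof.
move=> pd hB hG ht hp.
have [g hI] := gr_iso_of_bijective hB hG.
have gI := gr_iso_sym hI; have [gL _ _] := iso_morph gI.
have DP := transport_differential gI (ks_diffP G).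
have Dt j : g (ks_diff G (h (tvar (polyext A m) j))) = 0.
  by have [i ->] := ht j; rewrite ks_tvar (lf0 gL).
have Dm b : aug (g (ks_diff G (h (scal k b)))) = ks_diff E b.
  by rewrite -hp (isoK gI) pd hp aug_scal.
exists (@KsExt E k _ DP Dt Dm); apply/cdga_isoP; exists g, h; split=> // a.
by rewrite /= (isoK gI).
Qed.

(** A converse of [borel_extend]: later arguments see the order only through such an extension
    [F]. *)
Lemma borel_lt_ext (A : cdga) (E1 E2 : borel A) : borel_lt E1 E2 ->
  exists k, [/\ (0 < k)%N, rk E2 = (rk E1 + k)%N
    & exists F : ks_ext E1 k, cdga_iso E2 F].
Proof.
move=> [ltmn [p [[[pG pd] [h [hB hG ht hp]]] _ _]]].
exists (rk E2 - rk E1)%N; rewrite subn_gt0 (subnKC (ltnW ltmn)); split=> //.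
apply: (ks_ext_of_projection pd hB hG _ hp) => j.
have ltj : (rk E1 + j < rk E2)%N by rewrite -ltn_subRL.
by exists (Ordinal ltj); apply: ht.
Qed.
End BorelOrder.

(** * The Gysin sequence and the toral rank *)

Section FiniteCohomology.

(** Bounded families on [nat] are easier to concatenate than families on ['I_N]. *)
Lemma fin_cohP (A : cdga) : fin_coh A <->
  exists (N : nat) (z : nat -> A), (forall i, (i < N)%N -> diff (z i) = 0) /\
    forall a, diff a = 0 ->
      exists (c : nat -> rat) (b : A), a = \sum_(i < N) c i *: z i + diff b.
Proof.
split=> [[N [z [dz zP]]]|[N [z [dz zP]]]].
  pose ext (T : Type) (x : T) (f : 'I_N -> T) i := oapp f x (insub i).
  have extE T (x : T) f (i : 'I_N) : ext T x f i = f i by rewrite /ext valK.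
  exists N, (ext A 0 z); split=> [i lti|a /zP[c [b ->]]].
    by rewrite (extE A 0 z (Ordinal lti)).
  exists (ext rat 0 c), b; congr (_ + _).
  by apply: eq_bigr => i _; rewrite !extE.
exists N, z; split=> [i|a /zP[c [b ->]]]; first exact: dz.
by exists c, b.
Qed.

(* R plays the role of the graph of a map to rat^N that is defined on a space
   only up to a subspace, the v with R v 0; Gaussian elimination on N. *)
Lemma finite_span_of_relation (V : lmodType rat) (R : V -> (nat -> rat) -> Prop)
    (N : nat) (Z : V -> Prop) :
  (forall (x : rat) v w c e, R v c -> R w e ->
     R (x *: v + w) (fun i => x * c i + e i)) ->
  (forall (x : rat) v w, Z v -> Z w -> Z (x *: v + w)) ->
  (forall v, Z v -> exists2 c, R v c & forall i, (N <= i)%N -> c i = 0) ->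
  exists (M : nat) (s : nat -> V), (forall i, (i < M)%N -> Z (s i)) /\
    forall v, Z v -> exists e : nat -> rat,
      R (v - \sum_(i < M) e i *: s i) (fun=> 0).
Proof.
move=> RL; elim: N Z => [|N IH] Z ZL ZR.
  exists 0%N, (fun=> 0); split=> // v /ZR[c Rc c0]; exists (fun=> 0).
  rewrite big_ord0 subr0; rewrite (_ : (fun=> 0) = c) //.
  by apply: functional_extensionality => i; rewrite c0.
(* The elements with a representative whose coordinate [N] vanishes, to which the induction
   hypothesis applies. *)
pose Z' v := Z v /\ exists2 c, R v c & forall i, (N <= i)%N -> c i = 0.
have Z'L (x : rat) v w : Z' v -> Z' w -> Z' (x *: v + w).
  move=> [Zv [c Rc c0]] [Zw [e Re e0]]; split; first exact: ZL.
  exists (fun i => x * c i + e i); first exact: RL.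
  by move=> i lei; rewrite c0 ?e0 // mulr0 addr0.
have [M [s [sZ sP]]] := IH Z' Z'L (fun v => @proj2 _ _).
(* [z0] is a pivot: adding a multiple of it moves every element of [Z] into [Z']. *)
have [[z0 [c0 [Zz0 Rz0 c0N ne0]]]|no] := classic (exists z0 c0,
    [/\ Z z0, R z0 c0, forall i, (N < i)%N -> c0 i = 0 & c0 N != 0]).
  exists M.+1, (fun i => if i is j.+1 then s j else z0).
  split=> [[|i] lti|v Zv] //.
    by have [] := sZ i lti.
  have [c Rc cN] := ZR v Zv; pose x := - (c N / c0 N).
  have [|e Re] := sP (x *: z0 + v).
    split; first exact: ZL.
    exists (fun i => x * c0 i + c i); first exact: RL.
    move=> i; rewrite leq_eqVlt => /predU1P[<-|lti].
      by rewrite mulNr divfK // addNr.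
    by rewrite c0N ?cN // mulr0 addr0.
  exists (fun i => if i is j.+1 then e j else - x).
  rewrite big_ord_recl /=; move: Re; congr (R _ _).
  by rewrite scaleNr opprD opprK addrCA addrA.
(* Without a pivot, coordinate [N] is 0 for all representatives of the allowed length, so [Z'] is
   all of [Z]. *)
exists M, s; split=> [i /sZ[]//|v Zv]; apply: sP; split=> //.
have [c Rc cN] := ZR v Zv; exists c => // i; rewrite leq_eqVlt => /predU1P[<-|].
  apply/eqP/negPn/negP => ne0; apply: no; exists v, c; split=> //.
exact: cN.
Qed.

Section Gysin.
Variables (B : cdga) (E : ks_ext B 1).
Let t : polyext B 1 := tvar B ord0.
Let DP := ks_diffP E.

Lemma tvar_divE (q : polyext B 1) :
  exists v, q = scal 1 (aug q) + v * t.
Proof.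
elim/polyext_ind: q => [|p q [v ep] [w eq]|b m].
- exists 0.
  by rewrite (lf0 (@aug_linear _ _)) (lf0 (@scal_linear _ _)) mul0r addr0.
- exists (v + w); rewrite (lfD (@aug_linear _ _)) (lfD (@scal_linear _ _)).
  by rewrite mulrDl addrACA -ep -eq.
rewrite aug_mon; case: eqP => [->|/eqP ne0].
  by exists 0; rewrite tmon0 mulr1 mul0r addr0.
exists (scal 1 b * tmon B (m - U_(ord0))).
rewrite (lf0 (@scal_linear _ _)) add0r -mulrA; congr (_ * _).
rewrite -[t]/(tmon B U_(ord0)) -tmonD submK // lep1mP.
apply: contra ne0 => /eqP m0; apply/eqP/mnmP => i.
by rewrite (ord1 i) mnm0E.
Qed.

Lemma tvar_div (q : polyext B 1) : aug q = 0 -> exists v, q = v * t.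
Proof.
move=> e; have [v] := tvar_divE q.
by rewrite e (lf0 (@scal_linear _ _)) add0r; exists v.
Qed.

Lemma cf_mul_tvar (v : polyext B 1) m : cf (v * t) (m + U_(ord0)) = cf v m.
Proof. by rewrite addmC; apply: mcoeffMX. Qed.

Lemma tvar_reg : injective (fun v : polyext B 1 => v * t).
Proof.
move=> v w /= e; apply: cfP => m.
by rewrite -(cf_mul_tvar v) -(cf_mul_tvar w) e.
Qed.

(** For [n < 2] all coefficients of [v] vanish, so the truncated subtraction does no harm. *)
Lemma hom_tvar_div n (v : polyext B 1) : hom n (v * t) -> hom (n - 2) v.
Proof.
move=> h m; have := h (m + U_(ord0))%MM.
rewrite -[X in coef_hom n _ X]/(cf _ _) cf_mul_tvar => -[z|[k <- hk]].
  by left.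
right; exists k => //; rewrite mdegD mdeg1 addn1 doubleS !addnS.
by rewrite !subSS subn0.
Qed.

Lemma diff_mul_tvar v : ks_diff E (v * t) = ks_diff E v * t.
Proof. exact: (diff_mulX DP (@ks_tvar _ _ E) v U_(ord0)). Qed.

Lemma aug_ks_diff (q : polyext B 1) : aug (ks_diff E q) = diff (aug q).
Proof. by rewrite (aug_diff DP (@ks_tvar _ _ E)) ks_mod. Qed.

(* If D(scal b) = w t, the class of w in H(E) is the image of b in the Gysin
   sequence H(E) -> H(B) -> H(E). *)
Lemma fin_coh_ks1 : fin_coh E -> fin_coh B.
Proof.
move=> /fin_cohP[N [z [dz zP]]]; have DL := diffL DP.
have sL := @scal_linear B 1; have aL := @aug_linear B 1.
have dL := diffL (diffP B).
(* [c] gives coordinates, on the cocycles [z], of the image of [b] under the connecting map; they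
   are not unique, hence a relation. *)
pose R (b : B) (c : nat -> rat) := exists w y : polyext B 1,
  ks_diff E (scal 1 b) = w * t /\ w = \sum_(i < N) c i *: z i + ks_diff E y.
have [x v w c e|x v w|v dv|M [s [sZ sP]]] :=
    @finite_span_of_relation B R N (fun b => diff b = 0).
- move=> [u [y [eu ey]]] [u' [y' [eu' ey']]].
  exists (x *: u + u'), (x *: y + y'); split.
    by rewrite sL DL eu eu' mulrDl scalerAl.
  rewrite DL ey ey' scalerDr addrACA; congr (_ + _).
  rewrite scaler_sumr -big_split; apply: eq_bigr => i _ /=.
  by rewrite scalerDl scalerA.
- by move=> dv dw; rewrite dL dv dw scaler0 addr0.
- have [w ew] : exists w, ks_diff E (scal 1 v) = w * t.
    by apply: tvar_div; rewrite ks_mod.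
  have dw : ks_diff E w = 0.
    apply: tvar_reg; rewrite -diff_mul_tvar -ew mul0r; exact: (diff_sq DP).
  have [c [y ey]] := zP w dw.
  exists (fun i => if (i < N)%N then c i else 0); last first.
    by move=> i; rewrite ltnNge => ->.
  exists w, y; split=> //; rewrite {1}ey; congr (_ + _).
  by apply: eq_bigr => i _; rewrite ltn_ord.
apply/fin_cohP; exists (M + N)%N.
(* The [s] account for the image of the connecting map, the reductions of the [z] for its kernel. *)
exists (fun i => if (i < M)%N then s i else aug (z (i - M)%N)).
split=> [i lti|b db].
  case: ltnP => [/sZ //|leMi]; rewrite -aug_ks_diff.
  by rewrite [ks_diff E _]dz ?(lf0 aL) // -(ltn_add2l M) subnKC.
have [e [w [y [ew ey]]]] := sP b db.
have {}ey : w = ks_diff E y.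
  by rewrite ey big1 ?add0r // => i _; rewrite scale0r.
set b' := b - _ in ew.
(* The connecting class of [b'] is zero, and subtracting [y * t] lifts [b'] to a cocycle of [E]. *)
have [|c [x ex]] := zP (scal 1 b' - y * t).
  by rewrite /= (lfB DL) diff_mul_tvar -ey -ew subrr.
have eb' : b' = \sum_(i < N) c i *: aug (z i) + diff (aug x).
  have := congr1 (@aug B 1) ex; rewrite (lfB aL) aug_scal.
  have -> : aug (y * t) = 0.
    rewrite aug_mul -[t]/(tmon B U_(ord0)) -[tmon _ _]mul1r -scal1 aug_mon.
    by rewrite mnm1_eq0 mulr0.
  rewrite subr0 (lfD aL) (lf_sum aL) => ->; rewrite -aug_ks_diff; congr (_ + _).
  by apply: eq_bigr => i _; rewrite (lfZ aL).
exists (fun i => if (i < M)%N then e i else c (i - M)%N), (aug x).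
rewrite big_split_ord /=.
rewrite (eq_bigr (fun i : 'I_M => e i *: s i)); last first.
  by move=> i _; rewrite ltn_ord.
rewrite (eq_bigr (fun i : 'I_N => c i *: aug (z i))); last first.
  by move=> i _; rewrite ltnNge leq_addr /= addKn.
by rewrite -addrA -eb' /b' addrC subrK.
Qed.

(* H^n(A) = 0 for n >= N, which fails for N = 0 because of the class of 1. *)
Definition coh_vanishes (A : cdga) (N : nat) : Prop :=
  forall n (a : A), (N <= n)%N -> hom n a -> diff a = 0 ->
    a = 0 \/ exists k (b : A), [/\ k.+1 = n, hom k b & diff b = a].

(* Exactness of H^{n+1}(B) -> H^n(E) -t-> H^{n+2}(E), with descending induction
   on n. *)
Lemma coh_vanishes_ks1 M N : coh_vanishes E M -> coh_vanishes B N.+1 ->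
  coh_vanishes E N.
Proof.
move=> vM vN; have DL := diffL DP.
(* [d] bounds the distance from [n] to [M], from where on the cohomology of [E] vanishes; each step
   passes from [a] to [a * t]. *)
suff H d n (a : E) : (N <= n)%N -> (M <= n + d)%N -> hom n a -> diff a = 0 ->
    a = 0 \/ exists k (b : E), [/\ k.+1 = n, hom k b & diff b = a].
  by move=> n a leNn; apply: (H M) => //; apply: leq_addl.
elim: d n a => [|d IH] n a leNn leMn ha da.
  by apply: vM => //; rewrite -(addn0 n).
have hat : hom n.+2 (a * t : polyext B 1).
  by rewrite -[n.+2]addn2; apply: (@homM (polyext B 1)) => //; apply: hom_tvar.
have [||||at0|[k [y [[ek] hy Dy]]]] := IH n.+2 (a * t).
- by rewrite (leq_trans leNn) // ltnW.
- by rewrite !addSn ltnW // -addnS.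
- exact: hat.
- by rewrite [LHS]diff_mul_tvar [ks_diff E a]da mul0r.
- by left; apply: tvar_reg; rewrite /= at0 mul0r.
(* Since [y] bounds [a * t], its reduction is a cocycle of [B] of degree [n.+1], hence exact. *)
subst k; have [b hb db] : exists2 b, hom n b & diff b = aug y.
  have [|||y0|[j [b [[<-] hb db]]]] := vN n.+1 (aug y); last by exists b.
  - by [].
  - exact: (@aug_graded B 1).
  - rewrite -aug_ks_diff [ks_diff E y]Dy.
    rewrite aug_mul -[t]/(tmon B U_(ord0)) -[tmon _ _]mul1r -scal1 aug_mon.
    by rewrite mnm1_eq0 mulr0.
  by exists 0; [apply: hom0 | rewrite (lf0 (diffL (diffP B)))].
(* Corrected by a coboundary, [y] becomes divisible by [t], and the quotient bounds [a]. *)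
have [v ev] : exists v, y - ks_diff E (scal 1 b) = v * t.
  by apply: tvar_div; rewrite (lfB (@aug_linear B 1)) ks_mod db subrr.
have hv : hom (n.+1 - 2) v.
  apply: hom_tvar_div; rewrite -ev; apply: (@homD (polyext B 1)) => //.
  exact/homN/(diff_deg DP)/scal_graded.
have Dv : ks_diff E v = a.
  apply: tvar_reg; rewrite /= -diff_mul_tvar -ev (lfB DL) (diff_sq DP) subr0.
  exact: Dy.
(* In degree 0 there is no lower degree for [v], but there a coboundary is zero. *)
case: n ha hv {IH leNn leMn da hat hy Dy hb} => [|n] ha hv.
  left; have := component_of_hom 0 ha; rewrite eqxx -Dv => <-.
  exact: (component0_diff DP).
by right; exists n, v; split=> //; move: hv; rewrite !subSS subn0.
Qed.
End Gysin.

Lemma ks0_iso (B : cdga) (E : ks_ext B 0) : cdga_iso E B.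
Proof.
apply/cdga_isoP.
have aK : cancel (@aug B 0) (scal 0) by exact: scalK.
exists (@aug B 0), (scal 0); split; last first.
  by move=> q; rewrite /= (aug_diff (ks_diffP E) (@ks_tvar _ _ E)) ks_mod.
split=> //.
- by split; [apply: aug_linear | apply: aug1 | apply: aug_mul].
- exact: aug_graded.
- exact: scal_graded.
- exact: aug_scal.
Qed.

Lemma fin_coh_ks (B : cdga) r (E : ks_ext B r) : fin_coh E -> fin_coh B.
Proof.
elim: r B E => [|r IH] B E finE; first exact: fin_coh_iso (ks0_iso E) finE.
move: E finE; rewrite -addn1 => E finE.
have [E' [F iFE]] := ks_truncate E; apply: (IH _ E').
exact/(fin_coh_ks1 (E := F))/(fin_coh_iso (cdga_iso_sym iFE)).
Qed.

(** The finitely many representatives have bounded degrees; above them, taking components leaves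
    only a coboundary. *)
Lemma fin_coh_vanishes (A : cdga) : fin_coh A -> exists N, coh_vanishes A N.
Proof.
move=> /fin_cohP[N [z [dz zP]]].
have [M MP] : exists M, forall n i, (M <= n)%N -> (i < N)%N ->
    component n (z i) = 0.
  elim: N {dz zP} => [|N [M MP]]; first by exists 0%N.
  have [K KP] := component_bound (z N); exists (M + K)%N => n i len.
  rewrite ltnS leq_eqVlt => /predU1P[->|lti].
    by apply: KP; apply: leq_trans len; apply: leq_addl.
  by apply: MP lti; apply: leq_trans len; apply: leq_addr.
(* The extra 1 excludes degree 0, where a primitive would have no degree. *)
exists M.+1 => -[|n] a // len ha da; right.
have [c [b eb]] := zP a da; exists n, (component n b); split=> //.
  exact: component_hom.
rewrite -(component_diff (diffP A)).
have := component_of_hom n.+1 ha; rewrite eqxx => <-.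
rewrite [in RHS]eb (lfD (component_lin _)) (lf_sum (component_lin _)).
rewrite big1 ?add0r //.
by move=> i _; rewrite (lfZ (component_lin _)) MP ?scaler0 // ltnW.
Qed.

Lemma coh_vanishes0 (A : cdga) : ~ coh_vanishes A 0.
Proof.
move=> /(_ 0%N 1 isT (hom1 A) (diff_1 (diffP A)))[/eqP|[k [b []]]] //.
by rewrite oner_eq0.
Qed.

Lemma coh_vanishes_iso (A B : cdga) N :
  cdga_iso A B -> coh_vanishes A N -> coh_vanishes B N.
Proof.
move=> /cdga_isoP[f [g [fI fd]]] v n b len hb db.
have [fL _ _] := iso_morph fI.
have [||gb0|[k [a [ek ha da]]]] := v n (g b) len.
- exact: (iso_graded_inv fI).
- by apply: (can_inj (isoK fI)); rewrite fd (isoKV fI) db (lf0 fL).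
- by left; rewrite -[b](isoKV fI) gb0 (lf0 fL).
right; exists k, (f a); rewrite -fd da (isoKV fI); split=> //.
exact: (iso_graded fI).
Qed.

(** One variable is removed at a time. The vanishing bound drops by one each time and stays positive
    by [coh_vanishes0]. *)
Lemma toral_rank_bound (B : cdga) N r (E : ks_ext B r) :
  coh_vanishes B N -> fin_coh E -> (r < N)%N /\ coh_vanishes E (N - r).
Proof.
move=> vB; elim: r E => [|r IH] E finE.
  split; last first.
    by rewrite subn0; apply: coh_vanishes_iso vB; apply/cdga_iso_sym/ks0_iso.
  by case: N vB => // /coh_vanishes0.
move: E finE; rewrite -addn1 => E finE.
have [E' [F iFE]] := ks_truncate E.
have finF : fin_coh F by apply: fin_coh_iso finE; apply: cdga_iso_sym.
have [ltrN vE'] := IH E' (fin_coh_ks finF).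
have [M vM] := fin_coh_vanishes finF.
have v : coh_vanishes F (N - r.+1).
  by apply: (coh_vanishes_ks1 vM); rewrite subnSK.
rewrite {1 3}addn1; split; last exact: coh_vanishes_iso iFE v.
rewrite ltnNge; apply/negP; rewrite -subn_eq0 => /eqP z.
by rewrite z in v; apply: coh_vanishes0 v.
Qed.
End FiniteCohomology.

(** * The rational toral rank as an attained maximum *)

Section ToralRank.

Lemma bounded_nat_max (P : nat -> Prop) (N r : nat) :
  P r -> (forall r', P r' -> (r' <= N)%N) ->
  exists r0, P r0 /\ forall r', P r' -> (r' <= r0)%N.
Proof.
move=> Pr; elim: N => [|N IH] ub.
  by exists r; split=> // r' /ub; rewrite leqn0 => /eqP ->.
have [PN|nPN] := classic (P N.+1); first by exists N.+1.
apply: IH => r' Pr'; rewrite -ltnS ltn_neqAle ub // andbT.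
by apply/eqP => e; rewrite e in Pr'.
Qed.

(** [r0] is chosen by [epsilon], so a maximum must be exhibited: rank 0 comes from [triv_ext], the
    bound from [toral_rank_bound]. *)
Lemma r0_max (A : cdga) : fin_coh A ->
  toral_rank_ge A (r0 A) /\ forall r, toral_rank_ge A r -> (r <= r0 A)%N.
Proof.
move=> finA; have [N vN] := fin_coh_vanishes finA.
have [||r mr] := @bounded_nat_max (toral_rank_ge A) N 0%N.
- by exists (triv_ext A); apply: triv_fin.
- by move=> r [E finE]; have [/ltnW] := toral_rank_bound vN finE.
pose P r := toral_rank_ge A r /\ forall r', toral_rank_ge A r' -> (r' <= r)%N.
exact: (epsilon_spec (inhabits 0%N) P (ex_intro P r mr)).
Qed.

Lemma r0_iso (A B : cdga) : fin_coh A -> cdga_iso A B -> r0 A = r0 B.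
Proof.
move=> finA i; have finB := fin_coh_iso i finA.
have [[rA mA] [rB mB]] := (r0_max finA, r0_max finB).
apply/eqP; rewrite eqn_leq; apply/andP; split.
  exact/mB/(toral_rank_ge_iso i).
exact/mA/(toral_rank_ge_iso (cdga_iso_sym i)).
Qed.

(** An almost free action on the Borel space composes with the given one to an action on the
    original space. *)
Lemma r0_ks_ext (A : cdga) k (E : ks_ext A k) :
  degree1_trivial A -> fin_coh E -> (k + r0 E <= r0 A)%N.
Proof.
move=> A1 finE; have [[F finF] _] := r0_max finE.
have [_ mA] := r0_max (fin_coh_ks finE); apply: mA.
have [G GE] := ks_compose F A1; exists G; apply: fin_coh_iso finF.
apply/cdga_isoP; exists (@pjoin A k (r0 E)), (@psplit A k (r0 E)).
split; first exact/gr_iso_sym/psplit_iso.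
by move=> q; rewrite [RHS]GE.
Qed.
End ToralRank.

(** * The poset T_0(X) *)

Section QuotientTheory.
Variables (T : Type) (R : T -> T -> Prop).
Hypotheses (Rxx : forall x, R x x) (Rsym : forall x y, R x y -> R y x)
  (Rtrans : forall x y z, R x y -> R y z -> R x z).

Lemma class_eq x y : R x y -> class R x = class R y.
Proof.
move=> xy; apply: subset_eq_compat.
apply: functional_extensionality => z; apply: propositional_extensionality.
by split; apply: Rtrans => //; apply: Rsym.
Qed.

Lemma class_inj x y : class R x = class R y -> R x y.
Proof. by case=> ->. Qed.

Lemma in_class_class x : in_class x (class R x).
Proof. exact: Rxx. Qed.

Lemma in_class_eq x (P : quotient R) : in_class x P -> P = class R x.
Proof.
case: P => P [y ey]; subst P => yx; rewrite -(class_eq yx).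
exact: subset_eq_compat.
Qed.

Lemma quotient_surj (P : quotient R) : exists x, P = class R x.
Proof.
case: P => P [y ey]; subst P; exists y.
exact: subset_eq_compat.
Qed.
End QuotientTheory.

Section ToralPoset.
Variable A : cdga.
Hypotheses (A1 : degree1_trivial A) (finA : fin_coh A).
Implicit Types E : borel A.

Lemma borel_degree1 E : degree1_trivial E.
Proof. exact: polyext_degree1. Qed.

Lemma borel_iso_refl E : borel_iso E E.
Proof. by split=> //; apply: cdga_iso_refl. Qed.

Lemma borel_iso_sym E E' : borel_iso E E' -> borel_iso E' E.
Proof. by move=> [e /cdga_iso_sym]. Qed.

Lemma borel_iso_trans E E' E'' :
  borel_iso E E' -> borel_iso E' E'' -> borel_iso E E''.
Proof.
by move=> [e i] [e' i']; split; [rewrite e | apply: cdga_iso_trans i i'].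
Qed.

Definition xclass E : calX A := class (@borel_iso A) E.

Lemma in_xclass E (Y : calX A) : in_class E Y <-> Y = xclass E.
Proof.
split=> [|->]; last exact: (in_class_class borel_iso_refl).
exact: (in_class_eq borel_iso_sym borel_iso_trans).
Qed.

Lemma xclass_type E n k : calX_type (xclass E) n k <-> rk E = n /\ r0 E = k.
Proof.
split=> [[E' [/in_xclass/(class_inj borel_iso_refl)[e i] <- <-]]|[<- <-]].
  split=> //.
  by apply: r0_iso i; apply: borel_fin.
by exists E; split=> //; apply/in_xclass.
Qed.

Lemma xclass_sim E E' : calX_sim (xclass E) (xclass E') <->
  rk E = rk E' /\ r0 E = r0 E'.
Proof.
split=> [[n [k [/xclass_type[-> ->] /xclass_type[-> ->]]]] //|[en ek]].
by exists (rk E), (r0 E); split; apply/xclass_type.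
Qed.

Lemma xclass_surj (Y : calX A) : exists E, Y = xclass E.
Proof. exact: quotient_surj. Qed.

Lemma sim_refl (Y : calX A) : calX_sim Y Y.
Proof. by have [E ->] := xclass_surj Y; apply/xclass_sim. Qed.

Lemma sim_sym (Y Y' : calX A) : calX_sim Y Y' -> calX_sim Y' Y.
Proof. by move=> [n [k [h h']]]; exists n, k. Qed.

Lemma sim_trans (Y Y' Y'' : calX A) :
  calX_sim Y Y' -> calX_sim Y' Y'' -> calX_sim Y Y''.
Proof.
have [E ->] := xclass_surj Y; have [E' ->] := xclass_surj Y'.
have [E'' ->] := xclass_surj Y''.
move=> /xclass_sim[e1 e2] /xclass_sim[e1' e2'].
by apply/xclass_sim; rewrite e1 e2.
Qed.

Definition tclass E : T0 A := class (@calX_sim A) (xclass E).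

Lemma in_tclass (Y : calX A) E (P : T0 A) :
  in_class E Y -> in_class Y P -> P = tclass E.
Proof. by move=> /in_xclass ->; apply: (in_class_eq sim_sym sim_trans). Qed.

Lemma tclass_eq E E' : tclass E = tclass E' <-> rk E = rk E' /\ r0 E = r0 E'.
Proof.
split=> [/(class_inj sim_refl)/xclass_sim //|/xclass_sim].
exact: (class_eq sim_sym sim_trans).
Qed.

Lemma tclass_iso E E' : rk E = rk E' -> cdga_iso E E' -> tclass E = tclass E'.
Proof.
by move=> e i; apply/tclass_eq; split=> //; apply: r0_iso i; apply: borel_fin.
Qed.

Lemma tclass_surj (P : T0 A) : exists E, P = tclass E.
Proof.
have [Y ->] := quotient_surj P; have [E ->] := xclass_surj Y.
by exists E.
Qed.

(** A chosen representative, from which level and height are read off; [lev_tclass] and [hgt_tclass]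
    show that the choice is immaterial. *)
Definition trep (P : T0 A) : borel A :=
  proj1_sig (constructive_indefinite_description _ (tclass_surj P)).

Lemma trepK P : tclass (trep P) = P.
Proof.
by rewrite /trep; case: constructive_indefinite_description.
Qed.

Definition lev (P : T0 A) : nat := rk (trep P).
Definition hgt (P : T0 A) : nat := r0 (trep P).

Lemma lev_tclass E : lev (tclass E) = rk E.
Proof. by have /tclass_eq[] := trepK (tclass E). Qed.

Lemma hgt_tclass E : hgt (tclass E) = r0 E.
Proof. by have /tclass_eq[] := trepK (tclass E). Qed.

Lemma lev_hgt_inj P Q : lev P = lev Q -> hgt P = hgt Q -> P = Q.
Proof. by move=> el eh; rewrite -(trepK P) -(trepK Q); apply/tclass_eq. Qed.

(** [r0_ks_ext] is applied with [E] in the role of the base space. *)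
Lemma borel_lt_ranks E E' : borel_lt E E' ->
  (rk E < rk E')%N /\ (rk E' + r0 E' <= rk E + r0 E)%N.
Proof.
move=> /borel_lt_ext[k [k0 -> [F iF]]].
split; first by rewrite -addn1 leq_add2l.
rewrite -addnA leq_add2l (r0_iso (borel_fin E') iF).
by apply: (r0_ks_ext (@borel_degree1 E)); apply: fin_coh_iso iF (borel_fin E').
Qed.

Lemma tclass_lt E E' : borel_lt E E' -> T0_lt (tclass E) (tclass E').
Proof.
move=> ltE; apply: t_step; exists (xclass E), (xclass E'); split.
- exact: (in_class_class sim_refl).
- exact: (in_class_class sim_refl).
- by exists E, E'; split=> //; apply/in_xclass.
Qed.

Lemma T0_ltP P Q : T0_lt P Q ->
  (exists E E', [/\ P = tclass E, Q = tclass E' & borel_lt E E']) \/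
  (exists2 R, T0_lt P R & T0_lt R Q).
Proof.
case=> [{}Q [Y [Y' [YP YQ [E [E' [EY EY' ltE]]]]]]|R {}Q PR RQ].
  left; exists E, E'.
  by split=> //; [apply: in_tclass EY YP | apply: in_tclass EY' YQ].
by right; exists R.
Qed.

Lemma T0_lt_ranks P Q : T0_lt P Q ->
  (lev P < lev Q)%N /\ (lev Q + hgt Q <= lev P + hgt P)%N.
Proof.
elim=> [{}P {}Q [Y [Y' [YP YQ [E [E' [EY EY' ltE]]]]]]|
        x y z _ [l1 h1] _ [l2 h2]].
  rewrite (in_tclass EY YP) (in_tclass EY' YQ) !lev_tclass !hgt_tclass.
  exact: borel_lt_ranks.
by split; [apply: ltn_trans l1 l2 | apply: leq_trans h2 h1].
Qed.

(** An extension by two or more variables factors through its truncation to the first one, which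
    lies strictly between. *)
Lemma covers_lev P Q : covers P Q -> lev Q = (lev P).+1.
Proof.
move=> [PQ nb]; have [[E [E' [eP eQ ltE]]]|[R PR RQ]] := T0_ltP PQ; last first.
  by case: nb; exists R.
have [k [k0 ek [F iF]]] := borel_lt_ext ltE.
rewrite eP eQ !lev_tclass ek; case: k k0 ek F iF => [|[|k]] // _ ek F iF.
  by rewrite addn1.
case: nb; rewrite eP eQ.
have finF : fin_coh F := fin_coh_iso iF (borel_fin E').
(* [F1] keeps one new variable and [F2] adds the rest. [G1] and [G2] realize them as Borel models
   over [A], and [G2] has the class of [E']. *)
have [F1 [F2 iF2]] := @ks_truncate E 1 k.+1 F.
have finF2 : fin_coh F2 by apply: fin_coh_iso finF; apply: cdga_iso_sym.
have [G1 [rG1 iG1 ltG1]] :=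
  borel_extend A1 (isT : 0 < 1)%N (fin_coh_ks finF2).
have [F3 iF3] := ks_ext_iso F2 (cdga_iso_sym iG1).
have [G2 [rG2 iG2 ltG2]] :=
  borel_extend A1 (isT : 0 < k.+1)%N (fin_coh_iso iF3 finF2).
exists (tclass G1); split; first exact: tclass_lt.
rewrite (_ : tclass E' = tclass G2); first exact: tclass_lt.
apply: tclass_iso; first by rewrite rG2 rG1 ek -addnA.
apply: cdga_iso_trans iF _; apply: cdga_iso_trans (cdga_iso_sym iF2) _.
by apply: cdga_iso_trans iF3 _; apply: cdga_iso_sym.
Qed.

Lemma lt_covers P Q : T0_lt P Q -> lev Q = (lev P).+1 -> covers P Q.
Proof.
move=> PQ e; split=> // -[R [/T0_lt_ranks[l1 _] /T0_lt_ranks[l2 _]]].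
by have := leq_ltn_trans l1 l2; rewrite e ltnn.
Qed.

(** A maximal extension is truncated to its first variable. The remaining [k] variables bound the
    new height from below, [T0_lt_ranks] from above. *)
Lemma covers_above P k : hgt P = k.+1 ->
  exists Q, [/\ covers P Q, lev Q = (lev P).+1 & hgt Q = k].
Proof.
have [E ->] := tclass_surj P; rewrite hgt_tclass => ek.
have [[F finF] _] := r0_max (borel_fin E).
move: F finF; rewrite [r0 _]ek => F finF.
have [F1 [F2 iF2]] := @ks_truncate E 1 k F.
have finF2 : fin_coh F2 by apply: fin_coh_iso finF; apply: cdga_iso_sym.
have finF1 := fin_coh_ks finF2.
have [G [rG iG ltG]] := borel_extend A1 (isT : 0 < 1)%N finF1.
have lG : lev (tclass G) = (lev (tclass E)).+1 by rewrite !lev_tclass rG addn1.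
have PG := tclass_lt ltG.
exists (tclass G); split=> //; first exact: lt_covers.
apply/eqP; rewrite hgt_tclass eqn_leq; apply/andP; split.
  have [_] := T0_lt_ranks PG; rewrite lG !hgt_tclass [r0 (borel_cdga E)]ek.
  by rewrite addSnnS leq_add2l ltnS.
rewrite (r0_iso (borel_fin G) iG); have [_ m1] := r0_max finF1.
by apply: m1; exists F2.
Qed.

(** The last variable of a representative is set to 0. *)
Lemma covers_below P n : lev P = n.+1 ->
  exists2 Q, covers Q P & lev Q = n.
Proof.
have [E ->] := tclass_surj P; rewrite lev_tclass.
case: E => m E finE /= em; subst m; move: E finE; rewrite -addn1 => E finE.
have [E' [F iF]] := ks_truncate E.
have finF : fin_coh F by apply: fin_coh_iso finE; apply: cdga_iso_sym.
have finE' := fin_coh_ks finF.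
have [G [rG iG ltG]] := @borel_extend A (Borel finE') 1 F A1 isT finF.
have -> : tclass (Borel finE) = tclass G.
  apply: tclass_iso; first by rewrite rG.
  by apply: cdga_iso_trans (cdga_iso_sym iF) _; apply: cdga_iso_sym.
exists (tclass (Borel finE')); last by rewrite lev_tclass.
by apply: lt_covers; [apply: tclass_lt | rewrite !lev_tclass rG addn1].
Qed.

Lemma lev_P0 : lev (P0 finA) = 0%N. Proof. exact: lev_tclass. Qed.

Lemma r0_rk0 E : rk E = 0%N -> r0 E = r0 A.
Proof.
case: E => n E finE /= en; subst n.
exact: (r0_iso finE (ks0_iso E)).
Qed.

Lemma hgt_P0 : hgt (P0 finA) = r0 A.
Proof. by rewrite [hgt _]hgt_tclass r0_rk0. Qed.

Lemma lev0_P0 P : lev P = 0%N -> P = P0 finA.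
Proof.
move=> l0; apply: lev_hgt_inj; first by rewrite l0 lev_P0.
by rewrite hgt_P0; apply: r0_rk0.
Qed.

Lemma lev_hgt_le P : (lev P + hgt P <= r0 A)%N.
Proof.
have [E ->] := tclass_surj P; rewrite lev_tclass hgt_tclass.
exact: (r0_ks_ext A1 (borel_fin E)).
Qed.

Lemma double_indexP P s t :
  double_index P (s, t) <-> lev P = t /\ (hgt P + s + t)%N = r0 A.
Proof.
split=> [[Y [k [YP [E [EY /= <- <-]] e]]]|[el eh]].
  by rewrite (in_tclass EY YP) lev_tclass hgt_tclass.
exists (xclass (trep P)), (hgt P); split=> //.
  rewrite -[in X in in_class _ X](trepK P); exact: (in_class_class sim_refl).
exact/xclass_type.
Qed.
End ToralPoset.

(** * Based graphs *)

(* These conditions force lev to be the distance to the base point and hgt to be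
   the length of a longest path along which lev increases. *)
Record ranked (G : based_graph) (lev hgt : vertex G -> nat) : Prop := Ranked {
  rank_adj : forall P Q, adj P Q ->
    lev Q = (lev P).+1 /\ (hgt Q < hgt P)%N \/
    lev P = (lev Q).+1 /\ (hgt P < hgt Q)%N;
  rank_up : forall P k, hgt P = k.+1 ->
    exists Q, [/\ adj P Q, lev Q = (lev P).+1 & hgt Q = k];
  rank_down : forall P n, lev P = n.+1 -> exists2 Q, adj Q P & lev Q = n;
  rank_base : forall P, lev P = 0%N <-> P = base G
}.

Section RankedIso.
Variables (G G' : based_graph) (f : vertex G -> vertex G').
Variables (lev hgt : vertex G -> nat) (lev' hgt' : vertex G' -> nat).
Hypotheses (rG : ranked lev hgt) (rG' : ranked lev' hgt').
Hypotheses (fadj : forall P Q, adj P Q -> adj (f P) (f Q))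
  (fbase : f (base G) = base G').

(** A path descending from [P] to the base point is mapped to a path along which [lev'] changes by
    one per edge. *)
Lemma lev_morph_le P : (lev' (f P) <= lev P)%N.
Proof.
move e : (lev P) => n; elim: n P e => [|n IH] P e.
  by rewrite leqn0; apply/eqP/(rank_base rG'); move/(rank_base rG): e => ->.
have [Q QP eQ] := rank_down rG e.
have := IH Q eQ; case: (rank_adj rG' (fadj QP)) => -[-> _] //.
by move=> /ltnW/leq_trans; apply.
Qed.

(** A path climbing from [P] stays climbing since [f] keeps levels, and [hgt'] drops along each of
    its edges. *)
Lemma hgt_morph_le P :
  (forall Q, lev' (f Q) = lev Q) -> (hgt P <= hgt' (f P))%N.
Proof.
move=> levf; move e : (hgt P) => k; elim: k P e => [//|k IH] P e.
have [Q [PQ lQ eQ]] := rank_up rG e.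
have := IH Q eQ; case: (rank_adj rG' (fadj PQ)) => -[]; rewrite !levf lQ.
  by move=> _ h lek; apply: leq_ltn_trans h.
by move=> /eqP; rewrite ltn_eqF // ltnS leqnSn.
Qed.
End RankedIso.

(** Both inequalities are applied to [f] and to its inverse, levels first because the comparison of
    heights uses them. *)
Lemma ranked_iso (G G' : based_graph) (f : vertex G -> vertex G')
    lev hgt lev' hgt' :
  @ranked G lev hgt -> @ranked G' lev' hgt' ->
  bijective f -> (forall P Q, adj P Q <-> adj (f P) (f Q)) ->
  f (base G) = base G' ->
  forall P, lev' (f P) = lev P /\ hgt' (f P) = hgt P.
Proof.
move=> rG rG' [g fK gK] fadj fb.
have gadj P Q : adj P Q -> adj (g P) (g Q) by rewrite fadj !gK.
have fadj' P Q : adj P Q -> adj (f P) (f Q) by rewrite fadj.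
have gb : g (base G') = base G by rewrite -fb fK.
have levf P : lev' (f P) = lev P.
  apply/eqP; rewrite eqn_leq (lev_morph_le rG rG') //=.
  by rewrite -{1}(fK P) (lev_morph_le rG' rG).
have levg P : lev (g P) = lev' P by rewrite -{2}(gK P) levf.
move=> P; split=> //; apply/eqP.
rewrite eqn_leq (hgt_morph_le rG rG') // andbT.
by rewrite -{2}(fK P) (hgt_morph_le rG' rG).
Qed.

Lemma GH_ranked (A : cdga) (A1 : degree1_trivial A) (finA : fin_coh A) :
  @ranked (GH finA) (@lev A) (@hgt A).
Proof.
have cov (P Q : T0 A) : covers P Q -> lev Q = (lev P).+1 /\ (hgt Q < hgt P)%N.
  move=> PQ; have l := covers_lev A1 PQ; split=> //.
  have [PQ' _] := PQ; have [_] := T0_lt_ranks A1 PQ'.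
  by rewrite l addSnnS leq_add2l.
split=> [P Q [/cov|/cov]|P k /(covers_above A1)[Q [PQ lQ hQ]]||P];
  try by [left|right].
- by exists Q; split=> //; left.
- by move=> P n /(covers_below A1)[Q QP lQ]; exists Q => //; left.
- by split=> [/(lev0_P0 finA)|->]; [|apply: lev_P0].
Qed.

(** * Double indices and the realized Hasse diagram *)

Section DoubleIndex.
Variable A : cdga.
Hypotheses (A1 : degree1_trivial A) (finA : fin_coh A).
Implicit Types P Q : T0 A.

(** The double index as a function; the subtraction is exact by [lev_hgt_le]. *)
Definition index P : nat * nat := ((r0 A - (lev P + hgt P))%N, lev P).

Lemma double_indexE P st : double_index P st <-> st = index P.
Proof.
case: st => s t; rewrite double_indexP // /index; have le := lev_hgt_le A1 P.
split=> [[<- <-]|[-> ->]].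
  by rewrite addnAC (addnC (hgt P)) addKn.
by rewrite addnAC (addnC (hgt P)) subnKC.
Qed.

Lemma index_inj : injective index.
Proof.
move=> P Q [es el]; apply: (lev_hgt_inj el); apply: (@addnI (lev P)).
rewrite {2}el -(subKn (lev_hgt_le A1 P)) es subKn //; exact: lev_hgt_le.
Qed.

Lemma points_Hasse st : points (Hasse A) st <-> exists P, st = index P.
Proof. by split=> -[P /double_indexE]; exists P => //; apply/double_indexE. Qed.

Lemma segments_Hasse P Q :
  segments (Hasse A) (index P) (index Q) <-> edge P Q.
Proof.
split=> [[P' [Q' [/double_indexE/index_inj->
                   /double_indexE/index_inj->]]] //|e].
by exists P, Q; split=> //; apply/double_indexE.
Qed.

Lemma segments_points st st' : segments (Hasse A) st st' ->
  exists P Q, st = index P /\ st' = index Q.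
Proof.
by move=> [P [Q [/double_indexE-> /double_indexE-> _]]]; exists P, Q.
Qed.

Lemma index_P0 : index (P0 finA) = (0%N, 0%N).
Proof. by rewrite /index hgt_P0 lev_P0 subnn. Qed.

Lemma index_base P : index P = (0%N, 0%N) -> P = P0 finA.
Proof. by rewrite -index_P0 => /index_inj. Qed.
End DoubleIndex.

Lemma index_transport (A B : cdga) :
  degree1_trivial A -> degree1_trivial B -> Hasse A = Hasse B ->
  exists f : T0 A -> T0 B, forall P, index (f P) = index P.
Proof.
move=> A1 B1 e.
have ex (P : T0 A) : exists Q : T0 B, index Q = index P.
  have /(points_Hasse B1)[Q ->] : points (Hasse B) (index P).
    by rewrite -e; apply/(points_Hasse A1); exists P.
  by exists Q.
exists (fun P => proj1_sig (constructive_indefinite_description _ (ex P))) => P.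
exact: proj2_sig (constructive_indefinite_description _ (ex P)).
Qed.

Lemma diagram_eq (D D' : diagram) :
  (forall st, points D st <-> points D' st) ->
  (forall st st', segments D st st' <-> segments D' st st') -> D = D'.
Proof.
case: D D' => [p s] [p' s'] /= ep es; congr Diagram.
  apply: functional_extensionality => st.
  exact: propositional_extensionality.
apply: functional_extensionality => st.
by apply: functional_extensionality => st'; apply: propositional_extensionality.
Qed.

Theorem theorem1p5 (X Y : cdga)
    (minX : minimal_sullivan X) (minY : minimal_sullivan Y)
    (finX : fin_coh X) (finY : fin_coh Y) :
  Hasse X = Hasse Y <-> based_graph_iso (GH finX) (GH finY).
Proof.
have X1 := minimal_degree1_trivial minX.
have Y1 := minimal_degree1_trivial minY.
split=> [e|[f [bf fadj fbase]]].
  (* Equal point sets give index-preserving maps both ways, mutually inverse because the index is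
     injective. *)
  have [f fE] := index_transport X1 Y1 e.
  have [g gE] := index_transport Y1 X1 (esym e).
  exists f; split=> [|P Q|].
  - exists g => P; [apply: (index_inj X1) | apply: (index_inj Y1)];
      by rewrite ?gE ?fE ?gE.
  - apply: iff_trans (segments_Hasse Y1 (f P) (f Q)); rewrite !fE -e.
    exact: iff_sym (segments_Hasse X1 P Q).
  - by apply: (index_base Y1); rewrite fE index_P0.
have inv := ranked_iso (GH_ranked X1 finX) (GH_ranked Y1 finY) bf fadj fbase.
(* The first coordinate also involves the toral rank of the whole space, recovered as the height of
   the base point. *)
have r0E : r0 Y = r0 X.
  by have [_] := inv (P0 finX); rewrite [f _]fbase !hgt_P0.
have indexf P : index (f P) = index P.
  by have [el eh] := inv P; rewrite /index el eh r0E.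
have [g fK gK] := bf.
have indexg Q : index (g Q) = index Q by rewrite -indexf gK.
have sX := segments_Hasse X1; have sY := segments_Hasse Y1.
apply: diagram_eq => [st|st st'].
  split=> [/(points_Hasse X1)[P ->]|/(points_Hasse Y1)[Q ->]].
    by rewrite -indexf; apply/(points_Hasse Y1); exists (f P).
  by rewrite -indexg; apply/(points_Hasse X1); exists (g Q).
split=> h.
  have [P [Q [eP eQ]]] := segments_points X1 h; move: h.
  by rewrite eP eQ => /sX/fadj/sY; rewrite !indexf.
have [P [Q [eP eQ]]] := segments_points Y1 h; move: h.
rewrite eP eQ -(gK P) -(gK Q) => /sY/fadj/sX.
by rewrite !indexf.
Qed.
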